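(* Consider the finite-horizon leader-follower problem described in the context: minimize $J_T$ over all strategies of the form $u^0_t=g^0_t(x^0_t,\bar x_t)$ and $u^i_t=g^i_t(x^i_t,\bar x_t,x^0_t)$, $i\in\{1,\dots,n\}$, $t\in\{1,\dots,T\}$. Suppose that the initial states and noise processes are mutually independent in time, that for every $t\in\{1,\dots,T\}$ the matrices $Q_t+P_t+H_t$ and $\bar Q_t$ are positive semi-definite, and that for every $t\in\{1,\dots,T\}$ the matrices $R^0_t$ and $R_t$ are positive definite. Then the optimal strategy is linear and unique, and is given, for $t\in\{1,\dots,T\}$ and $i\in\{1,\dots,n\}$, by $$u^0_t=\bar L^{1,1}_t x^0_t+\bar L^{1,2}_t\bar x_t,\qquad u^i_t=\breve L_t x^i_t+\bar L^{2,1}_t x^0_t+(\bar L^{2,2}_t-\breve L_t)\bar x_t,$$ where $$\breve L_t=-\left(B_t^\intercal\breve M_{t+1}B_t+R_t\right)^{-1}B_t^\intercal\breve M_{t+1}A_t,$$ $$\bar L_t=\begin{bmatrix}\bar L^{1,1}_t&\bar L^{1,2}_t\\ \bar L^{2,1}_t&\bar L^{2,2}_t\end{bmatrix}=-\left(\bar B_t^\intercal\bar M_{t+1}\bar B_t+\bar R_t\right)^{-1}\bar B_t^\intercal\bar M_{t+1}\bar A_t,$$ each block $\bar L^{k,l}_t$ is $d_u\times d_x$, and $\breve M_t,\bar M_t$ are defined by the backward Riccati recursions, for $t\in\{1,\dots,T\}$, $$\breve M_t=-A_t^\intercal\breve M_{t+1}B_t\left(B_t^\intercal\breve M_{t+1}B_t+R_t\right)^{-1}B_t^\intercal\breve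 M_{t+1}A_t+A_t^\intercal\breve M_{t+1}A_t+Q_t+P_t+H_t,\qquad \breve M_{T+1}=0_{d_x\times d_x},$$ $$\bar M_t=-\bar A_t^\intercal\bar M_{t+1}\bar B_t\left(\bar B_t^\intercal\bar M_{t+1}\bar B_t+\bar R_t\right)^{-1}\bar B_t^\intercal\bar M_{t+1}\bar A_t+\bar A_t^\intercal\bar M_{t+1}\bar A_t+\bar Q_t,\qquad \bar M_{T+1}=0_{2d_x\times 2d_x}.$$
   Context: Let $n,T,d_x,d_u\in\mathbb{N}$. There is one leader (index $0$) and $n$ followers (indices $1,\dots,n$). At time $t\in\{1,\dots,T\}$, agent $i\in\{0,1,\dots,n\}$ has state $x^i_t\in\mathbb{R}^{d_x}$, action $u^i_t\in\mathbb{R}^{d_u}$ and random state noise $w^i_t\in\mathbb{R}^{d_x}$. The mean-field is $\bar x_t=\frac1n\sum_{i=1}^n x^i_t$. The dynamics are $$x^0_{t+1}=A^0_tx^0_t+B^0_tu^0_t+D^0_t\bar x_t+w^0_t,$$ $$x^i_{t+1}=A_tx^i_t+B_tu^i_t+D_t\bar x_t+E_tx^0_t+w^i_t,\quad i\in\{1,\dots,n\},$$ where all coefficient matrices are deterministic, real and of compatible dimensions. Information structure: $u^0_t=g^0_t(x^0_t,\bar x_t)$ with $g^0_t:(\mathbb{R}^{d_x})^2\to\mathbb{R}^{d_u}$, and $u^i_t=g^i_t(x^i_t,\bar x_t,x^0_t)$ with $g^i_t:(\mathbb{R}^{d_x})^3\to\mathbb{R}^{d_u}$ for $i\in\{1,\dots,n\}$.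 A strategy is the collection of all these functions; it is optimal if it minimizes $J_T$ among all such strategies. Cost: $$J_T=\mathbb{E}\Big[\sum_{t=1}^T\Big((x^0_t)^\intercal Q^0_tx^0_t+(u^0_t)^\intercal R^0_tu^0_t+\frac1n\sum_{i=1}^n\big((x^i_t)^\intercal Q_tx^i_t+(x^i_t-x^0_t)^\intercal P_t(x^i_t-x^0_t)+(u^i_t)^\intercal R_tu^i_t\big)+\frac1{2n^2}\sum_{i=1}^n\sum_{j=1}^n(x^i_t-x^j_t)^\intercal H_t(x^i_t-x^j_t)\Big)\Big],$$ where $Q^0_t,R^0_t,Q_t,P_t,R_t,H_t$ are symmetric. ''Mutually independent in time'' means that the random vectors $(x^0_1,\dots,x^n_1)$, $(w^0_1,\dots,w^n_1)$, $(w^0_2,\dots,w^n_2),\dots$ are mutually independent; the distributions need not be Gaussian. Define $$\bar A_t=\begin{bmatrix}A^0_t&D^0_t\\ E_t&A_t+D_t\end{bmatrix},\ \bar B_t=\begin{bmatrix}B^0_t&0\\0&B_t\end{bmatrix},\ \bar Q_t=\begin{bmatrix}Q^0_t+P_t&-P_t\\-P_t&Q_t+P_t\end{bmatrix},\ \bar R_t=\begin{bmatrix}R^0_t&0\\0&R_t\end{bmatrix}.$$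
   Formalization: The noises are assumed to have zero mean, and the noises and initial states finite second moments; strategies are Borel measurable; uniqueness means that every optimal strategy yields almost surely the same states and actions for t=1,…,T, not pointwise equality of the functions g. *)

(* Defs.v *)
From HB Require Import structures.
From mathcomp Require Import all_boot all_order all_algebra.
From mathcomp Require Import all_classical all_reals all_analysis.

Set Implicit Arguments.
Unset Strict Implicit.
Unset Printing Implicit Defensive.

Import Order.TTheory GRing.Theory Num.Theory.
Import numFieldNormedType.Exports.

Local Open Scope classical_set_scope.
Local Open Scope ring_scope.

(* Matrices carry the product sigma-algebra of their entries, i.e. the Borel
   sigma-algebra of R^(m x n). *)
Definition mx_entry_sets (R : realType) (m n : nat) : set (set 'M[R]_(m, n)) :=
  [set S | exists i j, exists2 B : set R,
     measurable B & S = (fun M : 'M[R]_(m, n) => M i j) @^-1` B].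

HB.instance Definition _ (R : realType) (m n : nat) :=
  @isMeasurable.Build (sigma_display (@mx_entry_sets R m n)) 'M[R]_(m, n)
    <<s (@mx_entry_sets R m n) >>
    (@sigma_algebra0 _ setT (@mx_entry_sets R m n))
    (@sigma_algebraC _ (@mx_entry_sets R m n))
    (@sigma_algebra_bigcup _ setT (@mx_entry_sets R m n)).

Definition mutually_independent (d d' : measure_display)
    (Om : measurableType d) (R : realType) (Pr : probability Om R)
    (I : finType) (V : measurableType d') (X : I -> Om -> V) : Prop :=
  forall (J : {set I}) (B : I -> set V),
    (forall k, k \in J -> measurable (B k)) ->
    Pr (\bigcap_(k in [set` J]) (X k @^-1` B k)) =
    (\prod_(k in J) Pr (X k @^-1` B k))%E.

Definition quad (R : realType) (p : nat) (M : 'M[R]_p) (v : 'cV[R]_p) : R :=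
  (v^T *m M *m v) 0 0.

(* Used for symmetric matrices only; symmetry is always stated separately. *)
Definition psdmx (R : realType) (p : nat) (M : 'M[R]_p) : Prop :=
  forall v, 0 <= quad M v.

Definition pdmx (R : realType) (p : nat) (M : 'M[R]_p) : Prop :=
  forall v, v != 0 -> 0 < quad M v.

(* Prefix l: leader; prefix f: followers.  Only times t = 1, ..., T matter. *)
Record lf_model (R : realType) (dx du : nat) := LFModel {
  lA : nat -> 'M[R]_dx;
  lB : nat -> 'M[R]_(dx, du);
  lD : nat -> 'M[R]_dx;
  lQ : nat -> 'M[R]_dx;
  lR : nat -> 'M[R]_du;
  fA : nat -> 'M[R]_dx;
  fB : nat -> 'M[R]_(dx, du);
  fD : nat -> 'M[R]_dx;
  fE : nat -> 'M[R]_dx;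
  fQ : nat -> 'M[R]_dx;
  fP : nat -> 'M[R]_dx;
  fR : nat -> 'M[R]_du;
  fH : nat -> 'M[R]_dx
}.

(* Agents are indexed by 'I_n.+1: the leader is ord0, and the i-th follower is
   lift ord0 i with i : 'I_n. *)
Definition leader (n : nat) : 'I_n.+1 := ord0.
Definition follower (n : nat) (i : 'I_n) : 'I_n.+1 := lift ord0 i.

Definition mean_field (R : realType) (n dx : nat)
    (x : 'I_n.+1 -> 'cV[R]_dx) : 'cV[R]_dx :=
  n%:R^-1 *: \sum_(i < n) x (follower i).

(* The arguments of gl t are (x^0_t, xbar_t); those of gf t i are
   (x^i_t, xbar_t, x^0_t). *)
Record strategy (R : realType) (n dx du : nat) := Strategy {
  gl : nat -> 'cV[R]_dx -> 'cV[R]_dx -> 'cV[R]_du;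
  gf : nat -> 'I_n -> 'cV[R]_dx -> 'cV[R]_dx -> 'cV[R]_dx -> 'cV[R]_du
}.

Definition admissible (R : realType) (n dx du T : nat)
    (g : strategy R n dx du) : Prop :=
  forall t, (1 <= t <= T)%N ->
    measurable_fun setT
      (fun z : 'cV[R]_dx * 'cV[R]_dx => gl g t z.1 z.2) /\
    forall i, measurable_fun setT
      (fun z : 'cV[R]_dx * 'cV[R]_dx * 'cV[R]_dx =>
         gf g t i z.1.1 z.1.2 z.2).

Definition control (R : realType) (n dx du : nat) (g : strategy R n dx du)
    (t : nat) (x : 'I_n.+1 -> 'cV[R]_dx) (k : 'I_n.+1) : 'cV[R]_du :=
  if unlift ord0 k is Some i
  then gf g t i (x (follower i)) (mean_field x) (x (leader n))
  else gl g t (x (leader n)) (mean_field x).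

Definition dynamics (R : realType) (n dx du : nat) (m : lf_model R dx du)
    (t : nat) (x : 'I_n.+1 -> 'cV[R]_dx) (u : 'I_n.+1 -> 'cV[R]_du)
    (w : 'I_n.+1 -> 'cV[R]_dx) (k : 'I_n.+1) : 'cV[R]_dx :=
  if unlift ord0 k is Some i
  then fA m t *m x (follower i) + fB m t *m u (follower i)
       + fD m t *m mean_field x + fE m t *m x (leader n) + w (follower i)
  else lA m t *m x (leader n) + lB m t *m u (leader n)
       + lD m t *m mean_field x + w (leader n).

(* Closed-loop trajectory for one realization of the primitive variables.
   Time starts at 1; the value at time 0 is a dummy. *)
Fixpoint state (R : realType) (n dx du : nat) (m : lf_model R dx du)
    (g : strategy R n dx du) (x1 : 'I_n.+1 -> 'cV[R]_dx)
    (w : nat -> 'I_n.+1 -> 'cV[R]_dx) (t : nat) : 'I_n.+1 -> 'cV[R]_dx :=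
  match t with
  | 0%N => x1
  | s.+1 => if s == 0%N then x1
            else let x := state m g x1 w s in
                 dynamics m s x (control g s x) (w s)
  end.

Definition action (R : realType) (n dx du : nat) (m : lf_model R dx du)
    (g : strategy R n dx du) (x1 : 'I_n.+1 -> 'cV[R]_dx)
    (w : nat -> 'I_n.+1 -> 'cV[R]_dx) (t : nat) : 'I_n.+1 -> 'cV[R]_du :=
  control g t (state m g x1 w t).

Definition stage_cost (R : realType) (n dx du : nat) (m : lf_model R dx du)
    (t : nat) (x : 'I_n.+1 -> 'cV[R]_dx) (u : 'I_n.+1 -> 'cV[R]_du) : R :=
  quad (lQ m t) (x (leader n)) + quad (lR m t) (u (leader n))
  + n%:R^-1 * (\sum_(i < n)
      (quad (fQ m t) (x (follower i))
       + quad (fP m t) (x (follower i) - x (leader n))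
       + quad (fR m t) (u (follower i))))
  + (2 * n%:R ^+ 2)^-1 * (\sum_(i < n) \sum_(j < n)
      quad (fH m t) (x (follower i) - x (follower j))).

Definition path_cost (R : realType) (n T dx du : nat) (m : lf_model R dx du)
    (g : strategy R n dx du) (x1 : 'I_n.+1 -> 'cV[R]_dx)
    (w : nat -> 'I_n.+1 -> 'cV[R]_dx) : R :=
  \sum_(1 <= t < T.+1)
    stage_cost m t (state m g x1 w t) (action m g x1 w t).

(* Extended-real: the path cost is nonnegative under the definiteness conditions
   on the weights, but a strategy need not have finite expected cost. *)
Definition total_cost (R : realType) (n T dx du : nat) (m : lf_model R dx du)
    (d : measure_display) (Om : measurableType d) (Pr : probability Om R)
    (x1 : 'I_n.+1 -> Om -> 'cV[R]_dx) (w : nat -> 'I_n.+1 -> Om -> 'cV[R]_dx)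
    (g : strategy R n dx du) : \bar R :=
  'E_Pr [fun om => path_cost T m g (x1 ^~ om) (fun t => w t ^~ om)].

Definition optimal (R : realType) (n T dx du : nat) (m : lf_model R dx du)
    (d : measure_display) (Om : measurableType d) (Pr : probability Om R)
    (x1 : 'I_n.+1 -> Om -> 'cV[R]_dx) (w : nat -> 'I_n.+1 -> Om -> 'cV[R]_dx)
    (g : strategy R n dx du) : Prop :=
  admissible T g /\
  forall g', admissible T g' ->
    (total_cost T m Pr x1 w g <= total_cost T m Pr x1 w g')%E.

Definition joint (R : realType) (n dx : nat) (Om : Type)
    (X : 'I_n.+1 -> Om -> 'cV[R]_dx) (om : Om) : 'M[R]_(dx, n.+1) :=
  \matrix_(a < dx, k < n.+1) X k om a 0.

(* Index 0 stands for the initial states, index t > 0 for the noises at t. *)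
Definition primitives (R : realType) (n T dx : nat) (Om : Type)
    (x1 : 'I_n.+1 -> Om -> 'cV[R]_dx) (w : nat -> 'I_n.+1 -> Om -> 'cV[R]_dx)
    (s : 'I_T.+1) : Om -> 'M[R]_(dx, n.+1) :=
  if s == 0%N :> nat then joint x1 else joint (w s).

Definition square_integrable_vec (d : measure_display) (Om : measurableType d)
    (R : realType) (Pr : probability Om R) (p : nat)
    (X : Om -> 'cV[R]_p) : Prop :=
  forall a, (fun om => X om a 0) \in Lfun Pr 2%:E.

Definition zero_mean_vec (d : measure_display) (Om : measurableType d)
    (R : realType) (Pr : probability Om R) (p : nat)
    (X : Om -> 'cV[R]_p) : Prop :=
  forall a, ('E_Pr [fun om => X om a ord0] = 0)%E.

Section Aggregate.
Variables (R : realType) (dx du : nat) (m : lf_model R dx du) (t : nat).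

Definition Abar : 'M[R]_(dx + dx) :=
  block_mx (lA m t) (lD m t) (fE m t) (fA m t + fD m t).
Definition Bbar : 'M[R]_(dx + dx, du + du) :=
  block_mx (lB m t) 0 0 (fB m t).
Definition Qbar : 'M[R]_(dx + dx) :=
  block_mx (lQ m t + fP m t) (- fP m t) (- fP m t) (fQ m t + fP m t).
Definition Rbar : 'M[R]_(du + du) :=
  block_mx (lR m t) 0 0 (fR m t).

End Aggregate.

Definition gram (R : realType) (p q : nat) (B : 'M[R]_(p, q)) (Rc : 'M[R]_q)
    (M : 'M[R]_p) : 'M[R]_q :=
  B^T *m M *m B + Rc.

Definition gain (R : realType) (p q : nat) (A : 'M[R]_p) (B : 'M[R]_(p, q))
    (Rc : 'M[R]_q) (M : 'M[R]_p) : 'M[R]_(q, p) :=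
  - (invmx (gram B Rc M) *m B^T *m M *m A).

Definition riccati (R : realType) (p q : nat) (A : 'M[R]_p) (B : 'M[R]_(p, q))
    (Q : 'M[R]_p) (Rc : 'M[R]_q) (M : 'M[R]_p) : 'M[R]_p :=
  - (A^T *m M *m B *m invmx (gram B Rc M) *m B^T *m M *m A)
  + A^T *m M *m A + Q.

(* Main.v *)
Require Import Defs.
From mathcomp Require Import all_boot all_order all_algebra.
From mathcomp Require Import all_classical all_reals all_analysis.
From mathcomp Require Import measurable_realfun ring.

Set Implicit Arguments.
Unset Strict Implicit.
Unset Printing Implicit Defensive.

Import Order.TTheory GRing.Theory Num.Theory.
Import numFieldNormedType.Exports.

Local Open Scope classical_set_scope.
Local Open Scope ring_scope.

(* A collection of vectors indexed by the agents splits into an aggregate part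
   (leader, mean-field) and the deviations of the followers from the mean-field.
   Under this splitting both the dynamics and the stage cost decouple into a
   linear-quadratic problem with matrices Abar, Bbar, Qbar, Rbar and n identical
   ones with matrices A, B, Q + P + H, R.  Completing squares along the two
   Riccati recursions rewrites the cost of every trajectory as
     base + sum of gaps + terms linear in the current noise,
   where base depends on the primitive variables only, and the gap at time t is
   a positive definite form in the distance from the action to the one that
   gstar prescribes.  A strategy of finite cost has square-integrable states and
   actions, since the weights on the actions are positive definite; as the noise
   is centered and independent of the past, the linear terms then have
   expectation zero.  Hence the cost exceeds that of gstar by the expected sum
   of gaps, which vanishes only if all gaps vanish almost surely. *)

(** * Quadratic forms and one step of the Riccati recursion *)

(** The polarization of [quad]. A rectangular [M] lets factors such as [A] and [B] be absorbed into
    the middle matrix, so that identities between forms reduce to identities between matrices. *)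
Definition bil (R : realType) (p q : nat) (M : 'M[R]_(p, q)) (u : 'cV[R]_p)
    (v : 'cV[R]_q) : R :=
  (u^T *m M *m v) 0 0.

Section Bilinear.
Variable R : realType.

Lemma quadE (p : nat) (M : 'M[R]_p) v : quad M v = bil M v v.
Proof. by []. Qed.

Lemma bilDl p q (M : 'M[R]_(p, q)) u1 u2 v :
  bil M (u1 + u2) v = bil M u1 v + bil M u2 v.
Proof. by rewrite /bil linearD /= !mulmxDl mxE. Qed.

Lemma bilDr p q (M : 'M[R]_(p, q)) u v1 v2 :
  bil M u (v1 + v2) = bil M u v1 + bil M u v2.
Proof. by rewrite /bil mulmxDr mxE. Qed.

Lemma bilZl p q (M : 'M[R]_(p, q)) c u v : bil M (c *: u) v = c * bil M u v.
Proof. by rewrite /bil linearZ /= -!scalemxAl mxE. Qed.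

Lemma bilZr p q (M : 'M[R]_(p, q)) c u v : bil M u (c *: v) = c * bil M u v.
Proof. by rewrite /bil -scalemxAr mxE. Qed.

Lemma bilNl p q (M : 'M[R]_(p, q)) u v : bil M (- u) v = - bil M u v.
Proof. by rewrite -scaleN1r bilZl mulN1r. Qed.

Lemma bilNr p q (M : 'M[R]_(p, q)) u v : bil M u (- v) = - bil M u v.
Proof. by rewrite -scaleN1r bilZr mulN1r. Qed.

Lemma bil0l p q (M : 'M[R]_(p, q)) v : bil M 0 v = 0.
Proof. by rewrite /bil trmx0 !mul0mx mxE. Qed.

Lemma bil0r p q (M : 'M[R]_(p, q)) u : bil M u 0 = 0.
Proof. by rewrite /bil mulmx0 mxE. Qed.

Lemma bil_suml p q (M : 'M[R]_(p, q)) (I : finType) (u : I -> 'cV[R]_p) v :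
  bil M (\sum_i u i) v = \sum_i bil M (u i) v.
Proof.
elim/big_rec2: _ => [|i y1 y2 _ <-]; first exact: bil0l.
by rewrite bilDl.
Qed.

Lemma bil_sumr p q (M : 'M[R]_(p, q)) (I : finType) u (v : I -> 'cV[R]_q) :
  bil M u (\sum_i v i) = \sum_i bil M u (v i).
Proof.
elim/big_rec2: _ => [|i y1 y2 _ <-]; first exact: bil0r.
by rewrite bilDr.
Qed.

Lemma bil_mxD p q (M N : 'M[R]_(p, q)) u v :
  bil (M + N) u v = bil M u v + bil N u v.
Proof. by rewrite /bil mulmxDr mulmxDl mxE. Qed.

Lemma bil_mxN p q (M : 'M[R]_(p, q)) u v : bil (- M) u v = - bil M u v.
Proof. by rewrite /bil mulmxN mulNmx mxE. Qed.

Lemma bil_mx0 p q (u : 'cV[R]_p) (v : 'cV[R]_q) : bil 0 u v = 0.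
Proof. by rewrite /bil mulmx0 mul0mx mxE. Qed.

Lemma bil_mulr p q r (M : 'M[R]_(p, q)) (A : 'M[R]_(q, r)) u v :
  bil M u (A *m v) = bil (M *m A) u v.
Proof. by rewrite /bil !mulmxA. Qed.

Lemma bil_mull p q r (M : 'M[R]_(p, q)) (A : 'M[R]_(p, r)) u v :
  bil M (A *m u) v = bil (A^T *m M) u v.
Proof. by rewrite /bil trmx_mul !mulmxA. Qed.

Lemma bil_tr p q (M : 'M[R]_(p, q)) u v : bil M u v = bil M^T v u.
Proof.
transitivity ((u^T *m M *m v)^T 0 0); first by rewrite [RHS]mxE.
by rewrite /bil !trmx_mul trmxK mulmxA.
Qed.

Lemma bilE p q (M : 'M[R]_(p, q)) u v :
  bil M u v = \sum_a \sum_b M a b * (u a 0 * v b 0).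
Proof.
rewrite /bil mxE exchange_big /=; apply: eq_bigr => b _.
by rewrite mxE mulr_suml; apply: eq_bigr => a _; rewrite mxE; ring.
Qed.

Lemma bil_block p q r s (M1 : 'M[R]_(p, q)) (M2 : 'M[R]_(p, r))
    (M3 : 'M[R]_(s, q)) (M4 : 'M[R]_(s, r)) u1 u2 v1 v2 :
  bil (block_mx M1 M2 M3 M4) (col_mx u1 u2) (col_mx v1 v2) =
  bil M1 u1 v1 + bil M2 u1 v2 + (bil M3 u2 v1 + bil M4 u2 v2).
Proof.
rewrite /bil tr_col_mx mul_row_block mul_row_col !mulmxDl !mxE.
ring.
Qed.

Lemma quadD p (M : 'M[R]_p) u v : M^T = M ->
  quad M (u + v) = quad M u + 2 * bil M u v + quad M v.
Proof.
move=> sM; rewrite !quadE !bilDl !bilDr.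
by rewrite (bil_tr M v u) sM; ring.
Qed.

Lemma psdmx0 p : psdmx (0 : 'M[R]_p).
Proof. by move=> v; rewrite quadE bil_mx0. Qed.

Lemma quad0 p (M : 'M[R]_p) : quad M 0 = 0.
Proof. exact: bil0l. Qed.

Lemma pdmx_psd p (M : 'M[R]_p) : pdmx M -> psdmx M.
Proof.
move=> pM v; have [->|/pM/ltW//] := eqVneq v 0.
by rewrite quad0.
Qed.

Lemma pdmx_eq0 p (M : 'M[R]_p) v : pdmx M -> quad M v = 0 -> v = 0.
Proof.
by move=> pM M0; apply/eqP/negP => /negP /pM; rewrite M0 ltxx.
Qed.

(** A row [r] with [r *m M^T = 0] satisfies [M *m r^T = 0], so the form vanishes at [r^T] and [r] is
    zero: the kernel is trivial. *)
Lemma pdmx_unit p (M : 'M[R]_p) : pdmx M -> M \in unitmx.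
Proof.
move=> pM; rewrite -unitmx_tr -row_free_unit -kermx_eq0.
apply/eqP/row_matrixP => i; rewrite row0.
have : row i (kermx M^T) *m M^T = 0 by rewrite -row_mul mulmx_ker row0.
set r := row i _ => rM; apply: trmx_inj; rewrite trmx0.
apply: (pdmx_eq0 pM); rewrite /quad trmxK.
by rewrite -mulmxA -[M]trmxK -trmx_mul rM trmx0 mulmx0 mxE.
Qed.

(* Cauchy-Schwarz for the form [M], between [u] and [M^-1 e_a]. *)
Lemma pdmx_coord_bound p (M : 'M[R]_p) (a : 'I_p) : M^T = M -> pdmx M ->
  exists2 C, 0 <= C & forall u : 'cV[R]_p, (u a 0) ^+ 2 <= C * quad M u.
Proof.
move=> sM pM; pose v : 'cV[R]_p := invmx M *m delta_mx a 0.
have Mv u : bil M u v = u a 0.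
  rewrite bil_mulr mulmxV ?pdmx_unit // /bil mulmx1.
  by rewrite -colE !mxE.
have v0 : v != 0.
  apply/eqP => v0; have := Mv (delta_mx a 0); rewrite v0 bil0r mxE !eqxx.
  by move/esym/eqP; rewrite oner_eq0.
exists (quad M v) => [|u]; first exact: (pdmx_psd pM).
have q0 := pM _ v0; set q := quad M v in q0 *.
(* Since [v] represents the [a]-th coordinate for the form, this value expands to
   [q * (q * quad M u - u a 0 ^+ 2)], and [q > 0] divides out. *)
have := pdmx_psd pM (q *: u - (u a 0) *: v).
rewrite quadE !(bilDl, bilDr, bilNl, bilNr, bilZl, bilZr).
rewrite (bil_tr M v u) sM Mv -!quadE -/q => h.
suff : 0 <= q * (q * quad M u - u a 0 ^+ 2) by rewrite pmulr_rge0 // subr_ge0.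
by apply: le_trans h _; rewrite le_eqVlt; apply/orP; left; apply/eqP; ring.
Qed.

End Bilinear.

Section RiccatiStep.
Variables (R : realType) (p q : nat).
Variables (A : 'M[R]_p) (B : 'M[R]_(p, q)) (Q : 'M[R]_p) (Rc : 'M[R]_q).
Variable M : 'M[R]_p.
Hypotheses (sRc : Rc^T = Rc) (pRc : pdmx Rc) (sM : M^T = M) (pM : psdmx M).

Lemma gram_sym : (gram B Rc M)^T = gram B Rc M.
Proof. by rewrite /gram linearD /= !trmx_mul trmxK sM sRc mulmxA. Qed.

Lemma gram_pd : pdmx (gram B Rc M).
Proof.
move=> u u0; rewrite quadE /gram bil_mxD -mulmxA -bil_mull -bil_mulr.
by rewrite ltr_wpDl //; [exact: pM|exact: pRc].
Qed.

Lemma gram_unit : gram B Rc M \in unitmx.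
Proof. exact: pdmx_unit gram_pd. Qed.

(** As a function of [u] the left side is quadratic with leading matrix [gram] and minimizer
    [gain *m z]. Completing the square there leaves the Riccati form as the minimum. *)
Lemma complete_square z u :
  quad Q z + quad Rc u + quad M (A *m z + B *m u) =
  quad (riccati A B Q Rc M) z
  + quad (gram B Rc M) (u - gain A B Rc M *m z).
Proof.
pose K := B^T *m M *m A; pose W := invmx (gram B Rc M) *m K.
have GW : gram B Rc M *m W = K by rewrite mulKVmx // gram_unit.
have -> : gain A B Rc M = - W by rewrite /gain /W /K !mulmxA.
have -> : riccati A B Q Rc M = - (K^T *m W) + A^T *m M *m A + Q.
  by rewrite /riccati /W /K !trmx_mul trmxK sM !mulmxA.
have KT : K^T = A^T *m M *m B by rewrite /K !trmx_mul trmxK sM mulmxA.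
have KE : B^T *m M *m A = K by [].
have GE : gram B Rc M = B^T *m M *m B + Rc by [].
have GT := gram_sym.
(* Of the inverse only [G *m W = K] is kept; with the symmetry of [G] the identity becomes
   polynomial in values of [bil]. *)
clearbody W K; move: (gram B Rc M) => G in GW GE GT *.
have WG : W^T *m G = K^T by rewrite -GW trmx_mul GT.
have WK : W^T *m K = K^T *m W by rewrite -WG -mulmxA GW.
rewrite mulNmx opprK !quadE.
rewrite !(bilDl, bilDr, bil_mxD, bil_mxN, bil_mulr, bil_mull).
rewrite !mulmxA KE -KT WG GW GE bil_mxD.
ring.
Qed.

Lemma riccati_sym : Q^T = Q -> (riccati A B Q Rc M)^T = riccati A B Q Rc M.
Proof.
move=> sQ; rewrite /riccati !linearD /= linearN /= !trmx_mul !trmxK sM sQ.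
by rewrite trmx_inv gram_sym !mulmxA.
Qed.

(** At the minimizing action the last term of [complete_square] vanishes, which exhibits the Riccati
    form as a sum of three nonnegative terms. *)
Lemma riccati_psd : psdmx Q -> psdmx (riccati A B Q Rc M).
Proof.
move=> pQ z; have := complete_square z (gain A B Rc M *m z).
rewrite subrr quad0 addr0 => <-.
by rewrite !addr_ge0 //; exact: pdmx_psd.
Qed.

End RiccatiStep.

(** * Splitting into mean-field and deviations *)

Section MeanField.
Variables (R : realType) (n : nat).
Hypothesis n_gt0 : (0 < n)%N.

(** The kind of vector on which [Abar], [Bbar], [Qbar] and [Rbar] act. The dimension [p] is free
    because states, actions and noises are all split. *)
Definition agg p (x : 'I_n.+1 -> 'cV[R]_p) : 'cV[R]_(p + p) :=
  col_mx (x (leader n)) (mean_field x).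

Definition dev p (x : 'I_n.+1 -> 'cV[R]_p) (i : 'I_n) : 'cV[R]_p :=
  x (follower i) - mean_field x.

Lemma mean_fieldD p (x y : 'I_n.+1 -> 'cV[R]_p) :
  mean_field (fun k => x k + y k) = mean_field x + mean_field y.
Proof. by rewrite /mean_field big_split scalerDr. Qed.

Lemma mean_fieldB p (x y : 'I_n.+1 -> 'cV[R]_p) :
  mean_field (fun k => x k - y k) = mean_field x - mean_field y.
Proof. by rewrite /mean_field sumrB scalerBr. Qed.

Lemma mean_field_mul p q (A : 'M[R]_(p, q)) (x : 'I_n.+1 -> 'cV[R]_q) :
  mean_field (fun k => A *m x k) = A *m mean_field x.
Proof. by rewrite /mean_field -scalemxAr mulmx_sumr. Qed.

Lemma mean_field_cst p (y : 'cV[R]_p) :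
  mean_field (fun _ : 'I_n.+1 => y) = y.
Proof.
rewrite /mean_field sumr_const card_ord.
by rewrite -[y *+ n]scaler_nat scalerA mulVf ?scale1r // pnatr_eq0 -lt0n.
Qed.

(** The mean-field does not see the leader, so a family defined by cases on the agent can be
    replaced by one uniform formula before linearity is applied. *)
Lemma eq_mean_field p (x y : 'I_n.+1 -> 'cV[R]_p) :
  (forall i, x (follower i) = y (follower i)) -> mean_field x = mean_field y.
Proof. by move=> xy; rewrite /mean_field; congr (_ *: _); exact: eq_bigr. Qed.

Lemma agg0 p : agg (fun _ : 'I_n.+1 => 0 : 'cV[R]_p) = 0.
Proof. by rewrite /agg mean_field_cst col_mx0. Qed.

Lemma dev0 p i : dev (fun _ : 'I_n.+1 => 0 : 'cV[R]_p) i = 0.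
Proof. by rewrite /dev mean_field_cst subrr. Qed.

Lemma aggD p (x y : 'I_n.+1 -> 'cV[R]_p) :
  agg (fun k => x k + y k) = agg x + agg y.
Proof. by rewrite /agg mean_fieldD add_col_mx. Qed.

Lemma devD p (x y : 'I_n.+1 -> 'cV[R]_p) i :
  dev (fun k => x k + y k) i = dev x i + dev y i.
Proof. by rewrite /dev mean_fieldD opprD addrACA. Qed.

Lemma aggB p (x y : 'I_n.+1 -> 'cV[R]_p) :
  agg (fun k => x k - y k) = agg x - agg y.
Proof. by rewrite /agg mean_fieldB opp_col_mx add_col_mx. Qed.

Lemma devB p (x y : 'I_n.+1 -> 'cV[R]_p) i :
  dev (fun k => x k - y k) i = dev x i - dev y i.
Proof. by rewrite /dev mean_fieldB !opprD addrACA. Qed.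

Lemma mean_fieldMn p (x : 'I_n.+1 -> 'cV[R]_p) :
  mean_field x *+ n = \sum_i x (follower i).
Proof.
rewrite -[LHS]scaler_nat /mean_field scalerA divff ?scale1r //.
by rewrite pnatr_eq0 -lt0n.
Qed.

Lemma sum_dev p (x : 'I_n.+1 -> 'cV[R]_p) : \sum_i dev x i = 0.
Proof. by rewrite sumrB sumr_const card_ord mean_fieldMn subrr. Qed.

Let n0 : n%:R != 0 :> R. Proof. by rewrite pnatr_eq0 -lt0n. Qed.

(** Parallel-axis identity: expanding around the mean, the terms linear in the deviations cancel by
    [sum_dev]. The centre [c] is the leader's state for the weight [fP] and zero for [fQ] and
    [fR]. *)
Lemma mean_quad p (M : 'M[R]_p) (c : 'cV[R]_p) (x : 'I_n.+1 -> 'cV[R]_p) :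
  n%:R^-1 * (\sum_i quad M (x (follower i) - c)) =
  quad M (mean_field x - c) + n%:R^-1 * (\sum_i quad M (dev x i)).
Proof.
have E i : quad M (x (follower i) - c) = quad M (mean_field x - c)
   + bil M (mean_field x - c) (dev x i) + bil M (dev x i) (mean_field x - c)
   + quad M (dev x i).
  have -> : x (follower i) - c = (mean_field x - c) + dev x i.
    by rewrite /dev [RHS]addrC addrA addrNK.
  by rewrite !quadE !(bilDl _ (_ - c)) !(bilDr _ _ (_ - c)); ring.
under eq_bigr do rewrite E.
rewrite !big_split /= -(bil_sumr M _ (dev x)) -(bil_suml M (dev x)) sum_dev.
rewrite bil0r bil0l !addr0.
rewrite sumr_const card_ord mulrDr -[quad M _ *+ n]mulr_natl mulrA.
by rewrite mulVf // mul1r.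
Qed.

(** Differences of followers are differences of deviations, and the mixed products sum to zero by
    [sum_dev]. Hence [fH] weighs only the deviations and is absent from [Qbar]. *)
Lemma sum_pair_quad p (M : 'M[R]_p) (x : 'I_n.+1 -> 'cV[R]_p) :
  (2 * n%:R ^+ 2)^-1 * (\sum_(i < n) \sum_(j < n)
     quad M (x (follower i) - x (follower j))) =
  n%:R^-1 * (\sum_i quad M (dev x i)).
Proof.
have E (i j : 'I_n) : quad M (x (follower i) - x (follower j)) =
   quad M (dev x i) + quad M (dev x j)
   - (bil M (dev x i) (dev x j) + bil M (dev x j) (dev x i)).
  have -> : x (follower i) - x (follower j) = dev x i - dev x j.
    by rewrite /dev opprB addrA addrNK.
  by rewrite !quadE !(bilDl, bilDr, bilNl, bilNr); ring.
(* Each deviation occurs n times through the first index and n times through the second. *)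
transitivity ((2 * n%:R ^+ 2)^-1 * (2 * n%:R * \sum_i quad M (dev x i))).
  congr (_ * _).
  under eq_bigr => i _.
    under eq_bigr do rewrite E.
    rewrite sumrB !big_split /= -(bil_sumr M _ (dev x)) -(bil_suml M (dev x)).
    rewrite sum_dev bil0r bil0l.
    rewrite addr0 subr0 sumr_const card_ord.
    over.
  rewrite big_split /= sumr_const card_ord sumrMnl -mulr2n.
  by set S := \sum_i _; rewrite -[S *+ n]mulr_natl; ring.
by field.
Qed.

End MeanField.

Section AggregateForms.
Variables (R : realType) (n : nat).

(** The direct sum of the aggregate problem and the n deviation problems; the weight 1/n is that of
    the followers in [stage_cost]. *)
Definition mfbil p (Ma : 'M[R]_(p + p)) (Md : 'M[R]_p)
    (x y : 'I_n.+1 -> 'cV[R]_p) : R :=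
  bil Ma (agg x) (agg y) + n%:R^-1 * (\sum_i bil Md (dev x i) (dev y i)).

Definition mfquad p (Ma : 'M[R]_(p + p)) (Md : 'M[R]_p)
    (x : 'I_n.+1 -> 'cV[R]_p) : R := mfbil Ma Md x x.

Lemma mfquadD p (Ma : 'M[R]_(p + p)) (Md : 'M[R]_p)
    (x y : 'I_n.+1 -> 'cV[R]_p) : Ma^T = Ma -> Md^T = Md ->
  mfquad Ma Md (fun k => x k + y k) =
  mfquad Ma Md x + 2 * mfbil Ma Md x y + mfquad Ma Md y.
Proof.
move=> sMa sMd; rewrite /mfquad /mfbil aggD -!quadE quadD //.
under eq_bigr do rewrite devD -quadE quadD //.
rewrite !big_split /= -mulr_sumr.
by under [X in _ = _ + (_ + _ * X)]eq_bigr do rewrite -quadE; ring.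
Qed.

Lemma mfquad_ge0 p (Ma : 'M[R]_(p + p)) (Md : 'M[R]_p)
    (x : 'I_n.+1 -> 'cV[R]_p) : psdmx Ma -> psdmx Md -> 0 <= mfquad Ma Md x.
Proof.
move=> pMa pMd; rewrite addr_ge0 ?mulr_ge0 ?invr_ge0 ?ler0n //.
  exact: pMa.
by apply: sumr_ge0 => i _; exact: pMd.
Qed.

(** A vanishing aggregate part makes the leader's entry and the mean-field zero; then each follower
    equals its own deviation, which vanishes too. *)
Lemma mfquad_eq0 p (Ma : 'M[R]_(p + p)) (Md : 'M[R]_p)
    (x : 'I_n.+1 -> 'cV[R]_p) : (0 < n)%N -> pdmx Ma -> pdmx Md ->
  mfquad Ma Md x = 0 -> forall k, x k = 0.
Proof.
move=> n_gt0 pMa pMd /eqP.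
have sd0 : 0 <= \sum_i bil Md (dev x i) (dev x i).
  by apply: sumr_ge0 => i _; exact: (pdmx_psd pMd).
rewrite paddr_eq0; last 2 first.
- exact: (pdmx_psd pMa).
- by rewrite mulr_ge0 ?invr_ge0 ?ler0n.
move=> /andP[/eqP/(pdmx_eq0 pMa) + ].
rewrite -[0]col_mx0 mulf_eq0 invr_eq0 pnatr_eq0 -leqn0 leqNgt n_gt0 /=.
move=> /eq_col_mx[x0 mx0].
rewrite psumr_eq0 => [/allP d0 k|i _]; last exact: (pdmx_psd pMd).
have [i ->|->] := unliftP ord0 k; last exact: x0.
have /eqP/(pdmx_eq0 pMd) := d0 i (mem_index_enum i).
by rewrite /dev mx0 subr0.
Qed.

End AggregateForms.

(** * Stage cost, dynamics and linear feedback in split coordinates *)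

Section Step.
Variables (R : realType) (n dx du : nat) (m : lf_model R dx du) (t : nat).
Hypothesis n_gt0 : (0 < n)%N.

(** The follower terms split by the parallel-axis identity. The mean-field part of the [fP] term
    supplies the off-diagonal blocks of [Qbar], and the pair term goes to the deviations. *)
Lemma stage_costE (x : 'I_n.+1 -> 'cV[R]_dx) (u : 'I_n.+1 -> 'cV[R]_du) :
  stage_cost m t x u =
  mfquad (Qbar m t) (fQ m t + fP m t + fH m t) x
  + mfquad (Rbar m t) (fR m t) u.
Proof.
rewrite /stage_cost sum_pair_quad // !big_split /= !mulrDr.
have mq0 p (M : 'M[R]_p) (y : 'I_n.+1 -> 'cV[R]_p) :
    n%:R^-1 * (\sum_i quad M (y (follower i))) =
    quad M (mean_field y) + n%:R^-1 * (\sum_i quad M (dev y i)).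
  have := mean_quad n_gt0 M 0 y; rewrite subr0.
  by under eq_bigr do rewrite subr0.
rewrite mean_quad // !mq0 /mfquad /mfbil /Qbar /Rbar /agg !bil_block.
under [in RHS]eq_bigr do rewrite !bil_mxD.
rewrite !big_split /= !quadE !(bilDl, bilDr, bilNl, bilNr, bil_mxD, bil_mxN).
by rewrite !bil_mx0; ring.
Qed.

Lemma dynamics_noise (x : 'I_n.+1 -> 'cV[R]_dx) (u : 'I_n.+1 -> 'cV[R]_du) w :
  dynamics m t x u w = fun k => dynamics m t x u (fun=> 0) k + w k.
Proof.
apply/funext => k; rewrite /dynamics.
by case: unliftP => [i ->|->]; rewrite addr0.
Qed.

Lemma mean_dynamics (x : 'I_n.+1 -> 'cV[R]_dx) (u : 'I_n.+1 -> 'cV[R]_du) w :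
  mean_field (dynamics m t x u w) =
  fA m t *m mean_field x + fB m t *m mean_field u + fD m t *m mean_field x
  + fE m t *m x (leader n) + mean_field w.
Proof.
(* The follower equation extended to all agents, as [eq_mean_field] permits. The coupling terms are
   written as constant functions of the agent so that [mean_field_cst] applies. *)
pose y k := fA m t *m x k + fB m t *m u k
  + (fun=> fD m t *m mean_field x) k + (fun=> fE m t *m x (leader n)) k + w k.
rewrite (@eq_mean_field _ _ _ _ y) /y; last first.
  by move=> i; rewrite /dynamics liftK.
by rewrite !mean_fieldD !mean_field_mul !mean_field_cst.
Qed.

Lemma agg_dynamics (x : 'I_n.+1 -> 'cV[R]_dx) (u : 'I_n.+1 -> 'cV[R]_du) w :
  agg (dynamics m t x u w) = Abar m t *m agg x + Bbar m t *m agg u + agg w.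
Proof.
rewrite /agg mean_dynamics /Abar /Bbar !mul_block_col !add_col_mx.
rewrite !mul0mx add0r addr0 mulmxDl /dynamics unlift_none.
congr col_mx; congr (_ + _); first by rewrite addrAC.
move: (fA m t *m _) (fB m t *m _) (fD m t *m _) (fE m t *m _) => a b c e.
by rewrite (addrAC a) (addrAC (a + c)) (addrC _ e).
Qed.

(** [fD] and [fE] couple all followers to the same two vectors, so these contributions cancel
    against the mean. *)
Lemma dev_dynamics (x : 'I_n.+1 -> 'cV[R]_dx) (u : 'I_n.+1 -> 'cV[R]_du) w i :
  dev (dynamics m t x u w) i =
  fA m t *m dev x i + fB m t *m dev u i + dev w i.
Proof.
rewrite /dev mean_dynamics /dynamics liftK !mulmxBr.
move: (fA m t *m x _) (fA m t *m mean_field _) (fB m t *m u _)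
  (fB m t *m mean_field _) (fD m t *m _) (fE m t *m _) => a a' b b' c e.
by apply/colP => k; rewrite !mxE; ring.
Qed.

End Step.

Section Feedback.
Variables (R : realType) (n dx du : nat).
Hypothesis n_gt0 : (0 < n)%N.
Variables (La : nat -> 'M[R]_(du + du, dx + dx)) (Ld : nat -> 'M[R]_(du, dx)).

(** The coefficient [drsubmx (La t) - Ld t] of the mean-field is chosen so that the aggregate action
    involves [La] alone and the deviations involve [Ld] alone. *)
Definition feedback : strategy R n dx du := Strategy
  (fun t (x0 xbar : 'cV[R]_dx) =>
     ulsubmx (La t) *m x0 + ursubmx (La t) *m xbar)
  (fun t (i : 'I_n) (xi xbar x0 : 'cV[R]_dx) =>
     Ld t *m xi + dlsubmx (La t) *m x0 + (drsubmx (La t) - Ld t) *m xbar).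

Lemma mean_feedback t (x : 'I_n.+1 -> 'cV[R]_dx) :
  mean_field (control feedback t x) =
  dlsubmx (La t) *m x (leader n) + drsubmx (La t) *m mean_field x.
Proof.
pose y k := Ld t *m x k + (fun=> dlsubmx (La t) *m x (leader n)) k
  + (fun=> (drsubmx (La t) - Ld t) *m mean_field x) k.
rewrite (@eq_mean_field _ _ _ _ y) /y; last first.
  by move=> i; rewrite /control liftK.
rewrite !mean_fieldD mean_field_mul !mean_field_cst // mulmxBl.
by rewrite [LHS]addrC addrA subrK addrC.
Qed.

Lemma agg_feedback t (x : 'I_n.+1 -> 'cV[R]_dx) :
  agg (control feedback t x) = La t *m agg x.
Proof.
rewrite -[La t in RHS]submxK /agg mul_block_col mean_feedback.
by rewrite /control unlift_none.
Qed.

Lemma dev_feedback t (x : 'I_n.+1 -> 'cV[R]_dx) i :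
  dev (control feedback t x) i = Ld t *m dev x i.
Proof.
rewrite /dev mean_feedback /control liftK /= mulmxBl mulmxBr.
move: (Ld t *m x _) (Ld t *m mean_field x) (dlsubmx _ *m _) (drsubmx _ *m _).
by move=> a a' b c; apply/colP => k; rewrite !mxE; ring.
Qed.

End Feedback.

(** Dynamic programming for an arbitrary action: after the splitting, [complete_square] is used once
    for the aggregate and once per follower. The last parenthesis comes from expanding the value at
    the noise-free successor plus [w]. *)
Lemma bellman_step (R : realType) (n dx du : nat) (m : lf_model R dx du) t
    (La : nat -> 'M[R]_(du + du, dx + dx)) (Ld : nat -> 'M[R]_(du, dx))
    (Ma : 'M[R]_(dx + dx)) (Md : 'M[R]_dx)
    (x : 'I_n.+1 -> 'cV[R]_dx) (u : 'I_n.+1 -> 'cV[R]_du) w :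
  (0 < n)%N ->
  (Rbar m t)^T = Rbar m t -> pdmx (Rbar m t) ->
  (fR m t)^T = fR m t -> pdmx (fR m t) ->
  Ma^T = Ma -> psdmx Ma -> Md^T = Md -> psdmx Md ->
  La t = gain (Abar m t) (Bbar m t) (Rbar m t) Ma ->
  Ld t = gain (fA m t) (fB m t) (fR m t) Md ->
  stage_cost m t x u + mfquad Ma Md (dynamics m t x u w) =
  mfquad (riccati (Abar m t) (Bbar m t) (Qbar m t) (Rbar m t) Ma)
         (riccati (fA m t) (fB m t) (fQ m t + fP m t + fH m t) (fR m t) Md) x
  + mfquad (gram (Bbar m t) (Rbar m t) Ma) (gram (fB m t) (fR m t) Md)
      (fun k => u k - control (feedback n La Ld) t x k)
  + (2 * mfbil Ma Md (dynamics m t x u (fun=> 0)) w + mfquad Ma Md w).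
Proof.
move=> n_gt0 sRa pRa sRd pRd sMa pMa sMd pMd LaE LdE.
rewrite stage_costE // dynamics_noise.
rewrite (mfquadD (dynamics m t x u (fun=> 0)) w) //.
rewrite -(addrA (mfquad Ma Md _) (2 * _)) [LHS]addrA; congr (_ + _).
rewrite /mfquad /mfbil agg_dynamics // aggB agg_feedback // agg0 // addr0.
under [X in _ + _ + (_ + _ * X) = _]eq_bigr do
  rewrite dev_dynamics // dev0 // addr0.
under [X in _ = _ + (_ + _ * X)]eq_bigr do rewrite devB dev_feedback //.
rewrite LaE LdE.
(* Collect the aggregate terms and the terms of each follower, so that [complete_square] matches
   each group. *)
transitivity
  (quad (Qbar m t) (agg x) + quad (Rbar m t) (agg u)
   + quad Ma (Abar m t *m agg x + Bbar m t *m agg u)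
   + n%:R^-1 * (\sum_i (quad (fQ m t + fP m t + fH m t) (dev x i)
      + quad (fR m t) (dev u i)
      + quad Md (fA m t *m dev x i + fB m t *m dev u i)))).
  by rewrite !big_split /= !quadE; ring.
rewrite complete_square //.
under [X in _ + _ * X = _]eq_bigr do rewrite complete_square //.
by rewrite big_split /= !quadE; ring.
Qed.

(** * Measurability and independence *)

Section MatrixMeasurability.
Context (d : measure_display) (Om : measurableType d) (R : realType).

Lemma measurable_mxP p q (f : Om -> 'M[R]_(p, q)) :
  measurable_fun setT f <->
  forall i j, measurable_fun setT (fun om => f om i j).
Proof.
split=> [mf i j _ B mB|mf].
  have := mf measurableT ((fun M : 'M[R]_(p, q) => M i j) @^-1` B).
  by apply; apply: sub_sigma_algebra; exists i, j, B.
apply: (measurability (@mx_entry_sets R p q)) => // _ [S [i [j [B mB ->]]] <-].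
exact: mf.
Qed.

Lemma measurable_addmx p q (f g : Om -> 'M[R]_(p, q)) :
  measurable_fun setT f -> measurable_fun setT g ->
  measurable_fun setT (fun om => f om + g om).
Proof.
move=> /measurable_mxP mf /measurable_mxP mg; apply/measurable_mxP => i j.
under eq_fun do rewrite mxE.
exact: measurable_funD.
Qed.

Lemma measurable_mulmx p q r (A : 'M[R]_(p, q)) (f : Om -> 'M[R]_(q, r)) :
  measurable_fun setT f -> measurable_fun setT (fun om => A *m f om).
Proof.
move=> /measurable_mxP mf; apply/measurable_mxP => i j.
under eq_fun do rewrite mxE.
by apply: measurable_sum => k; apply: measurable_funM => //; exact: mf.
Qed.

Lemma measurable_bil p q (M : 'M[R]_(p, q)) (f : Om -> 'cV[R]_p)
    (g : Om -> 'cV[R]_q) :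
  measurable_fun setT f -> measurable_fun setT g ->
  measurable_fun setT (fun om => bil M (f om) (g om)).
Proof.
move=> /measurable_mxP mf /measurable_mxP mg.
under eq_fun do rewrite bilE.
apply: measurable_sum => a; apply: measurable_sum => b.
apply: measurable_funM => //; apply: measurable_funM; [exact: mf|exact: mg].
Qed.

Variable n : nat.

Lemma measurable_mean_field p (x : 'I_n.+1 -> Om -> 'cV[R]_p) :
  (forall k, measurable_fun setT (x k)) ->
  measurable_fun setT (fun om => mean_field (x ^~ om)).
Proof.
move=> mx; apply/measurable_mxP => i j.
under eq_fun do rewrite mxE summxE.
apply: measurable_funM => //; apply: measurable_sum => k.
by have /measurable_mxP := mx (follower k); apply.
Qed.

Lemma measurable_agg p (x : 'I_n.+1 -> Om -> 'cV[R]_p) :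
  (forall k, measurable_fun setT (x k)) ->
  measurable_fun setT (fun om => agg (x ^~ om)).
Proof.
move=> mx; apply/measurable_mxP => i j.
have /measurable_mxP mm := measurable_mean_field mx.
have /measurable_mxP m0 := mx (leader n).
rewrite /agg; case: (split_ordP i) => k ->.
  by under eq_fun do rewrite col_mxEu; exact: m0.
by under eq_fun do rewrite col_mxEd; exact: mm.
Qed.

Lemma measurable_dev p (x : 'I_n.+1 -> Om -> 'cV[R]_p) i :
  (forall k, measurable_fun setT (x k)) ->
  measurable_fun setT (fun om => dev (x ^~ om) i).
Proof.
move=> mx; apply/measurable_mxP => a b.
have /measurable_mxP mm := measurable_mean_field mx.
have /measurable_mxP m0 := mx (follower i).
rewrite (_ : (fun om => _) =
    (fun om => x (follower i) om a b) \- (fun om => mean_field (x ^~ om) a b)).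
  exact: measurable_funB.
by apply/funext => om; rewrite /dev /= !mxE.
Qed.

End MatrixMeasurability.

(** * Independence of one variable from a family of others *)

Section Independence.
Context (d d' : measure_display) (Om : measurableType d) (R : realType).
Variables (Pr : probability Om R) (I : finType) (V : measurableType d').
Variable X : I -> Om -> V.
Hypothesis mX : forall k, measurable_fun setT (X k).
Hypothesis indX : mutually_independent Pr X.
Variables (J : {set I}) (i : I).
Hypothesis iJ : i \notin J.

(* A pi-system generating the sigma-algebra of the family (X k), k in J. *)
Definition cylinders : set (set Om) :=
  [set S | exists2 B : I -> set V, (forall k, measurable (B k)) &
     S = \bigcap_(k in [set` J]) (X k @^-1` B k)].

Lemma cylinder_preimage k (B : set V) : k \in J -> measurable B ->
  cylinders (X k @^-1` B).
Proof.
move=> kJ mB; exists (fun l => if l == k then B else setT).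
  by move=> l; case: ifP.
apply/seteqP; split=> [om Bom l _ /=|om /(_ k kJ) /=]; last by rewrite eqxx.
by case: eqP => // ->.
Qed.

Lemma cylinders_measurable : cylinders `<=` measurable.
Proof.
move=> _ [B mB ->]; apply: fin_bigcap_measurable => [|k _].
  exact: finite_finset.
by rewrite -[_ @^-1` _]setTI; exact: mX.
Qed.

Lemma cylinders_setI : setI_closed cylinders.
Proof.
move=> _ _ [B mB ->] [C mC ->]; exists (fun k => B k `&` C k).
  by move=> k; exact: measurableI.
apply/seteqP; split=> [om [HB HC] k kJ|om H].
  by split; [exact: HB|exact: HC].
by split=> k kJ; have [] := H k kJ.
Qed.

(** As functions of [S], both sides are finite measures: [Pr] restricted to an event, and [Pr]
    scaled by its probability. They agree on the pi-system [cylinders] by mutual independence over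
    [J] and over [i |: J], hence on the generated sigma-algebra. *)
Lemma independent_past (S : set Om) (B : set V) : <<s cylinders >> S ->
  measurable B -> Pr (S `&` X i @^-1` B) = (Pr S * Pr (X i @^-1` B))%E.
Proof.
move=> sS mB.
have mXB : measurable (X i @^-1` B) by rewrite -[_ @^-1` _]setTI; exact: mX.
pose c : {nonneg R} := NngNum (fine_ge0 (measure_ge0 Pr (X i @^-1` B))).
have cE : (c%:num)%:E = Pr (X i @^-1` B) by rewrite fineK // fin_num_measure.
pose m1 : {measure set Om -> \bar R} := mrestr Pr mXB.
pose m2 : {measure set Om -> \bar R} := mscale c Pr.
suff : m1 S = m2 S by rewrite /m1 /m2 /= /mrestr /mscale cE muleC.
apply: (g_sigma_algebra_measure_unique cylinders cylinders_measurable
  (fun=> setT)) => //.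
- move=> _; exists (fun=> setT) => //.
  by apply/seteqP; split.
- by rewrite bigcup_const.
- exact: cylinders_setI.
- move=> _ [C mC ->]; rewrite /m1 /m2 /= /mrestr /mscale /= cE.
  (* Overriding [C] at [i] gives a single family that serves both index sets; as [i] is outside [J],
     nothing changes on [J]. *)
  pose C' k := if k == i then B else C k.
  have mC' k : measurable (C' k) by rewrite /C'; case: ifP.
  have := indX (J := i |: J) (B := C') (fun k _ => mC' k).
  have := indX (J := J) (B := C') (fun k _ => mC' k).
  have CC' k : k \in J -> C' k = C k.
    by rewrite /C'; case: eqP => // ->; rewrite (negPf iJ).
  have C'i : C' i = B by rewrite /C' eqxx.
  rewrite big_setU1 //= C'i => <-.
  have -> : \bigcap_(k in [set` i |: J]) (X k @^-1` C' k) =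
      \bigcap_(k in [set` J]) (X k @^-1` C k) `&` X i @^-1` B.
    apply/seteqP; split=> [om H|om [H HB] k].
      split=> [k kJ|].
        by rewrite -CC' //; apply: H; rewrite /= in_setU1 kJ orbT.
      by have := H i; rewrite /= in_setU1 eqxx C'i; apply.
    rewrite /= in_setU1 => /predU1P[->|kJ]; first by rewrite C'i.
    by rewrite CC' //; exact: H.
  move=> ->; congr (_ * Pr _)%E.
  by apply: eq_bigcapr => k kJ; rewrite CC'.
- move=> _; rewrite /m1 /= /mrestr setTI.
  exact: le_lt_trans (probability_le1 _ _) (ltry _).
Qed.

End Independence.

(** Independence on rectangles identifies the joint law of the pair with the product law, and the
    product of two square-integrable variables is integrable, so Fubini applies. *)
Lemma expectation_mul_indep0 (d : measure_display) (Om : measurableType d)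
    (R : realType) (Pr : probability Om R) (X Y : {mfun Om >-> R}) :
  (X : Om -> R) \in Lfun Pr 2%:E -> (Y : Om -> R) \in Lfun Pr 2%:E ->
  (forall A B, measurable A -> measurable B ->
     Pr (X @^-1` A `&` Y @^-1` B) = (Pr (X @^-1` A) * Pr (Y @^-1` B))%E) ->
  ('E_Pr[Y] = 0 -> 'E_Pr[fun om => (X om * Y om)%R] = 0)%E.
Proof.
move=> X2 Y2 indXY EY0.
pose Z : {mfun Om >-> (R * R)%type} :=
  mfun_Sub (mem_set
    (measurable_fun_pair (measurable_funP X) (measurable_funP Y))).
pose f (z : R * R) := (z.1 * z.2)%:E.
have mf : measurable_fun setT f.
  by apply/measurable_EFinP; apply: measurable_funM.
have iXY : Pr.-integrable setT (f \o Z).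
  exact/Lfun1_integrable/Lfun2_mul_Lfun1.
have PZ : forall S, measurable S ->
    (distribution Pr X \x distribution Pr Y)%E S = distribution Pr Z S.
  by apply: product_measure_unique => A B mA mB; exact: indXY.
rewrite unlock -[LHS]/(\int[Pr]_(om in Z @^-1` setT) (f \o Z) om)%E.
rewrite -integral_pushforward //.
have prodE (h : R * R -> \bar R) :
    (\int[distribution Pr Z]_z h z =
     \int[distribution Pr X \x distribution Pr Y]_z h z)%E.
  by apply: eq_measure_integral => S mS _; exact/esym/PZ.
have if_ : (distribution Pr X \x distribution Pr Y)%E.-integrable setT f.
  have /integrableP[_] := integrable_pushforward
    (measurable_funP Z) (mu := Pr) mf (D := setT) iXY measurableT.
  by rewrite prodE => ?; apply/integrableP.
(* The integral over [Y] is innermost: for each fixed value of [X] it is a multiple of the mean of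
   [Y], hence zero. *)
rewrite prodE -integral12_prod_meas1 //.
rewrite integral0_eq // => x _; rewrite /fubini_F /f /=.
have iY : Pr.-integrable setT (EFin \o Y).
  by apply/Lfun1_integrable; apply: Lfun_subset12 Y2; exact: fin_num_measure.
have iY' : (distribution Pr Y).-integrable setT EFin.
  by apply: integrable_pushforward => //; exact/measurable_EFinP.
under eq_integral do rewrite EFinM.
rewrite integralZl // integral_pushforward //.
by move: EY0; rewrite unlock preimage_setT /comp => ->; rewrite mule0.
Qed.


(** * Square integrability *)

Section SquareIntegrable.
Context (d : measure_display) (Om : measurableType d) (R : realType).
Variable Pr : probability Om R.

Lemma Lfun_measurable p (f : Om -> R) :
  f \in Lfun Pr p -> measurable_fun setT f.
Proof. by move=> /sub_Lfun_mfun/set_mem. Qed.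

Lemma LfunD p (f g : Om -> R) : (1 <= p)%E -> f \in Lfun Pr p ->
  g \in Lfun Pr p -> (fun om => f om + g om) \in Lfun Pr p.
Proof. by move=> p1; have [_] := Lfun_addr_closed Pr p1; apply. Qed.

Lemma LfunMl p c (f : Om -> R) : (1 <= p)%E -> f \in Lfun Pr p ->
  (fun om => c * f om) \in Lfun Pr p.
Proof.
move=> p1 fp; have [L0 LP] := Lfun_submod_closed Pr p1.
have := LP c f 0 fp L0.
rewrite (_ : _ + 0 = (fun om => c * f om)) //.
by apply/funext => om; exact: addr0.
Qed.

Lemma Lfun_sum p (I : Type) (r : seq I) (P : pred I) (F : I -> Om -> R) :
  (1 <= p)%E -> (forall i, P i -> F i \in Lfun Pr p) ->
  (fun om => \sum_(i <- r | P i) F i om) \in Lfun Pr p.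
Proof.
move=> p1 FL; elim: r => [|i r IH].
  rewrite (_ : (fun _ => _) = 0); first by have [] := Lfun_addr_closed Pr p1.
  by apply/funext => om; rewrite big_nil.
have [Pi|/negPf nPi] := boolP (P i); last first.
  by under eq_fun do rewrite big_cons nPi.
under eq_fun do rewrite big_cons Pi.
by apply: LfunD => //; exact: FL.
Qed.

(** Used with [h] a multiple of the path cost, so that a pathwise bound on a square becomes a finite
    second moment. *)
Lemma Lfun2_sqr_le (f h : Om -> R) : measurable_fun setT f ->
  h \in Lfun Pr 1 -> (forall om, f om ^+ 2 <= h om) -> f \in Lfun Pr 2%:E.
Proof.
move=> mf /Lfun1_integrable/integrableP[mh ih] fh.
rewrite inE; apply/andP; split; rewrite inE //=.
rewrite /finite_norm unlock poweR_lty //; apply: le_lt_trans ih.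
apply: ge0_le_integral => //.
- by move=> om _; rewrite lee_fin powR_ge0.
- apply/measurable_EFinP; apply: (measurableT_comp (measurable_powR _)).
  exact: measurableT_comp.
- exact: measurableT_comp.
move=> om _; rewrite /= lee_fin powR_mulrn // -normrX.
by rewrite ger0_norm ?sqr_ge0 // (le_trans (fh om)) // ler_norm.
Qed.

Lemma Lfun1_ge0_lty (f : Om -> R) : measurable_fun setT f ->
  (forall om, 0 <= f om) -> ('E_Pr[f] < +oo)%E -> f \in Lfun Pr 1.
Proof.
move=> mf f0 fy; apply/Lfun1_integrable/integrableP; split.
  exact/measurable_EFinP.
move: fy; rewrite unlock; congr (_ < _)%E; apply: eq_integral => om _.
by rewrite gee0_abs // lee_fin.
Qed.

(** Integrability is bundled in because the expectation is split along sums of integrable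
    functions. *)
Definition centered (f : Om -> R) : Prop :=
  f \in Lfun Pr 1 /\ ('E_Pr[f] = 0)%E.

Lemma centeredD (f g : Om -> R) : centered f -> centered g ->
  centered (fun om => f om + g om).
Proof.
move=> [f1 f0] [g1 g0]; split; first exact: LfunD.
by rewrite expectationD // f0 g0 adde0.
Qed.

Lemma centeredMl c (f : Om -> R) : centered f -> centered (fun om => c * f om).
Proof.
move=> [f1 f0]; split; first exact: LfunMl.
by under eq_fun do rewrite mulrC; rewrite expectationZl // f0 mule0.
Qed.

Lemma centered_sum (I : Type) (r : seq I) (P : pred I) (F : I -> Om -> R) :
  (forall i, P i -> centered (F i)) ->
  centered (fun om => \sum_(i <- r | P i) F i om).
Proof.
move=> FL; elim: r => [|i r IH].
  under eq_fun do rewrite big_nil.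
  by split; [exact: Lfun_cst|exact: expectation_cst].
have [Pi|/negPf nPi] := boolP (P i); last first.
  by under eq_fun do rewrite big_cons nPi.
under eq_fun do rewrite big_cons Pi.
by apply: centeredD => //; exact: FL.
Qed.

Notation L2 := (square_integrable_vec Pr).

Lemma L2D p (X Y : Om -> 'cV[R]_p) : L2 X -> L2 Y -> L2 (fun om => X om + Y om).
Proof.
move=> X2 Y2 a; under eq_fun do rewrite mxE.
by apply: LfunD => //; rewrite lee1n.
Qed.

Lemma L2_mulmx p q (A : 'M[R]_(p, q)) (X : Om -> 'cV[R]_q) :
  L2 X -> L2 (fun om => A *m X om).
Proof.
move=> X2 a; under eq_fun do rewrite mxE.
by apply: Lfun_sum => [|b _]; [|apply: LfunMl => //]; rewrite lee1n.
Qed.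

Lemma zero_mean_centered p (X : Om -> 'cV[R]_p) : L2 X -> zero_mean_vec Pr X ->
  forall a, centered (fun om => X om a 0).
Proof.
move=> X2 X0 a; split; last exact: X0.
by apply: Lfun_subset12 (X2 a); exact: fin_num_measure.
Qed.

Lemma Lfun1_bil p q (M : 'M[R]_(p, q)) (X : Om -> 'cV[R]_p)
    (Y : Om -> 'cV[R]_q) :
  L2 X -> L2 Y -> (fun om => bil M (X om) (Y om)) \in Lfun Pr 1.
Proof.
move=> X2 Y2; under eq_fun do rewrite bilE.
apply: Lfun_sum => // a _; apply: Lfun_sum => // b _; apply: LfunMl => //.
exact: Lfun2_mul_Lfun1.
Qed.

(** Independence is exploited entry by entry, hence the form of the hypothesis. *)
Lemma centered_bil p q (M : 'M[R]_(p, q)) (X : Om -> 'cV[R]_p)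
    (Y : Om -> 'cV[R]_q) :
  (forall a b, centered (fun om => X om a 0 * Y om b 0)) ->
  centered (fun om => bil M (X om) (Y om)).
Proof.
move=> XY; under eq_fun do rewrite bilE.
by apply: centered_sum => a _; apply: centered_sum => b _; exact: centeredMl.
Qed.

Variable n : nat.

Lemma L2_mean_field p (x : 'I_n.+1 -> Om -> 'cV[R]_p) :
  (forall k, L2 (x k)) -> L2 (fun om => mean_field (x ^~ om)).
Proof.
move=> x2 a; under eq_fun do rewrite mxE summxE.
apply: LfunMl; first by rewrite lee1n.
by apply: Lfun_sum => [|i _]; [rewrite lee1n|exact: x2].
Qed.

Lemma L2_agg p (x : 'I_n.+1 -> Om -> 'cV[R]_p) :
  (forall k, L2 (x k)) -> L2 (fun om => agg (x ^~ om)).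
Proof.
move=> x2 a; rewrite /agg; case: (split_ordP a) => k ->.
  by under eq_fun do rewrite col_mxEu; exact: x2.
by under eq_fun do rewrite col_mxEd; exact: L2_mean_field.
Qed.

Lemma L2_dev p (x : 'I_n.+1 -> Om -> 'cV[R]_p) i :
  (forall k, L2 (x k)) -> L2 (fun om => dev (x ^~ om) i).
Proof.
(* Subtraction is written with the scalar matrix -1, to reuse closure under sums and matrix
   products. *)
move=> x2; rewrite (_ : (fun om => _) =
  fun om => x (follower i) om + (-1)%:M *m mean_field (x ^~ om)).
  by apply: L2D => //; apply/L2_mulmx/L2_mean_field.
by apply/funext => om; rewrite mul_scalar_mx scaleN1r.
Qed.

Lemma centered_mean_field p (x : 'I_n.+1 -> Om -> 'cV[R]_p) :
  (forall k a, centered (fun om => x k om a 0)) ->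
  forall a, centered (fun om => mean_field (x ^~ om) a 0).
Proof.
move=> x0 a; under eq_fun do rewrite mxE summxE.
by apply: centeredMl; apply: centered_sum => i _; exact: x0.
Qed.

Lemma centered_agg p (x : 'I_n.+1 -> Om -> 'cV[R]_p) :
  (forall k a, centered (fun om => x k om a 0)) ->
  forall a, centered (fun om => agg (x ^~ om) a 0).
Proof.
move=> x0 a; rewrite /agg; case: (split_ordP a) => k ->.
  by under eq_fun do rewrite col_mxEu; exact: x0.
by under eq_fun do rewrite col_mxEd; exact: centered_mean_field.
Qed.

Lemma centered_dev p (x : 'I_n.+1 -> Om -> 'cV[R]_p) i :
  (forall k a, centered (fun om => x k om a 0)) ->
  forall a, centered (fun om => dev (x ^~ om) i a 0).
Proof.
move=> x0 a; rewrite (_ : (fun om => _) =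
  fun om => x (follower i) om a 0 + (-1) * mean_field (x ^~ om) a 0).
  by apply: centeredD => //; apply/centeredMl/centered_mean_field.
by apply/funext => om; rewrite mulN1r /dev !mxE.
Qed.

Lemma Lfun1_mfbil p (Ma : 'M[R]_(p + p)) (Md : 'M[R]_p)
    (x y : 'I_n.+1 -> Om -> 'cV[R]_p) :
  (forall k, L2 (x k)) -> (forall k, L2 (y k)) ->
  (fun om => mfbil Ma Md (x ^~ om) (y ^~ om)) \in Lfun Pr 1.
Proof.
move=> x2 y2; apply: LfunD => //; first by apply: Lfun1_bil; exact: L2_agg.
apply: LfunMl => //; apply: Lfun_sum => // i _.
by apply: Lfun1_bil; exact: L2_dev.
Qed.

End SquareIntegrable.

(** * Measurability of the closed-loop trajectory *)

Section MeasurableTrajectory.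
Context (d : measure_display) (Om : measurableType d) (R : realType).
Variables (n dx du : nat).

Lemma measurable_mfbil p (Ma : 'M[R]_(p + p)) (Md : 'M[R]_p)
    (x y : 'I_n.+1 -> Om -> 'cV[R]_p) :
  (forall k, measurable_fun setT (x k)) ->
  (forall k, measurable_fun setT (y k)) ->
  measurable_fun setT (fun om => mfbil Ma Md (x ^~ om) (y ^~ om)).
Proof.
move=> mx my; apply: measurable_funD.
  by apply: measurable_bil; exact: measurable_agg.
apply: measurable_funM => //; apply: measurable_sum => i.
by apply: measurable_bil; exact: measurable_dev.
Qed.

Lemma measurable_control T (g : strategy R n dx du) t
    (x : 'I_n.+1 -> Om -> 'cV[R]_dx) : admissible T g -> (1 <= t <= T)%N ->
  (forall k, measurable_fun setT (x k)) ->
  forall k, measurable_fun setT (fun om => control g t (x ^~ om) k).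
Proof.
move=> ag tT mx k; have [mgl mgf] := ag t tT.
have mm := measurable_mean_field mx.
rewrite /control; case: unliftP => [i _|_].
  apply: (measurableT_comp (mgf i)
    (g := fun om =>
      (x (follower i) om, mean_field (x ^~ om), x (leader n) om))).
  by apply: measurable_fun_pair => //; exact: measurable_fun_pair.
apply: (measurableT_comp mgl
  (g := fun om => (x (leader n) om, mean_field (x ^~ om)))).
exact: measurable_fun_pair.
Qed.

Lemma measurable_dynamics (m : lf_model R dx du) t
    (x : 'I_n.+1 -> Om -> 'cV[R]_dx) (u : 'I_n.+1 -> Om -> 'cV[R]_du)
    (w : 'I_n.+1 -> Om -> 'cV[R]_dx) :
  (forall k, measurable_fun setT (x k)) ->
  (forall k, measurable_fun setT (u k)) ->
  (forall k, measurable_fun setT (w k)) ->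
  forall k, measurable_fun setT
    (fun om => dynamics m t (x ^~ om) (u ^~ om) (w ^~ om) k).
Proof.
move=> mx mu mw k; have mm := measurable_mean_field mx.
rewrite /dynamics; case: unliftP => [i _|_];
  by repeat apply: measurable_addmx => //; exact: measurable_mulmx.
Qed.

(** Only noises at times before [t] are assumed measurable, and the measurable space is arbitrary:
    the lemma serves both for the full sigma-algebra and for the one generated by the past. *)
Lemma measurable_state T (m : lf_model R dx du) (g : strategy R n dx du) t
    (x1 : 'I_n.+1 -> Om -> 'cV[R]_dx) (w : nat -> 'I_n.+1 -> Om -> 'cV[R]_dx) :
  admissible T g -> (1 <= t <= T)%N ->
  (forall k, measurable_fun setT (x1 k)) ->
  (forall s k, (1 <= s < t)%N -> measurable_fun setT (w s k)) ->
  forall k, measurable_fun setT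
    (fun om => state m g (x1 ^~ om) (fun s => w s ^~ om) t k).
Proof.
move=> ag; elim: t => [//|[|t] IH] tT mx1 mw k; first exact: mx1.
have tT' : (1 <= t.+1 <= T)%N by case/andP: tT => _ /ltnW.
pose X k0 om := state m g (x1 ^~ om) (fun s => w s ^~ om) t.+1 k0.
have mX k0 : measurable_fun setT (X k0).
  by apply: IH => // s k1 /andP[s1 st]; apply: mw; rewrite s1 (ltn_trans st).
have mw' k0 : measurable_fun setT (w t.+1 k0) by apply: mw; rewrite /= ltnS.
apply: (measurable_dynamics m t.+1 (x := X)
  (u := fun k0 om => control g t.+1 (X ^~ om) k0)) => //.
exact: (measurable_control (x := X) ag).
Qed.

End MeasurableTrajectory.

(* This bound turns a finite expected cost into square-integrable actions. *)
Lemma mfquad_coord_bound (R : realType) (n p : nat) (Ma : 'M[R]_(p + p))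
    (Md : 'M[R]_p) (k : 'I_n.+1) (a : 'I_p) : (0 < n)%N ->
  Ma^T = Ma -> pdmx Ma -> Md^T = Md -> pdmx Md ->
  exists2 C, 0 <= C & forall u : 'I_n.+1 -> 'cV[R]_p,
    (u k a 0) ^+ 2 <= C * mfquad Ma Md u.
Proof.
move=> n_gt0 sMa pMa sMd pMd.
have n0 : 0 < n%:R :> R by rewrite ltr0n.
have bil_dev_ge0 (u : 'I_n.+1 -> 'cV[R]_p) i : 0 <= bil Md (dev u i) (dev u i).
  exact: (pdmx_psd pMd).
have agg_le (u : 'I_n.+1 -> 'cV[R]_p) : quad Ma (agg u) <= mfquad Ma Md u.
  rewrite /mfquad /mfbil -quadE lerDl mulr_ge0 ?invr_ge0 ?(ltW n0) //.
  by apply: sumr_ge0 => i _; exact: bil_dev_ge0.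
have dev_le (u : 'I_n.+1 -> 'cV[R]_p) i :
    quad Md (dev u i) <= n%:R * mfquad Ma Md u.
  rewrite /mfquad /mfbil mulrDr mulVKf ?gt_eqF // (bigD1 i) //= addrCA.
  rewrite lerDl addr_ge0 //.
    by rewrite mulr_ge0 ?(ltW n0) //; exact: (pdmx_psd pMa).
  by apply: sumr_ge0 => j _; exact: bil_dev_ge0.
have [C1 C1_0 aggC] := pdmx_coord_bound (lshift p a) sMa pMa.
have [C2 C2_0 mfC] := pdmx_coord_bound (rshift p a) sMa pMa.
have [C3 C3_0 devC] := pdmx_coord_bound a sMd pMd.
case: (unliftP ord0 k) => [i ->|->]; last first.
  exists C1 => // u; have := aggC (agg u); rewrite col_mxEu => /le_trans; apply.
  exact: ler_wpM2l.
(* A follower is its deviation plus the mean-field, and the square of a sum is at most twice the sum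
   of squares. The factor n undoes the weight 1/n of one deviation. *)
exists (2 * (C3 * n%:R + C2)).
  by rewrite mulr_ge0 // addr_ge0 // mulr_ge0 // ltW.
move=> u; have := mfC (agg u); rewrite col_mxEd => mu.
have := devC (dev u i); rewrite mxE [X in (_ + X) ^+ 2 <= _]mxE => du.
have := le_trans mu (ler_wpM2l C2_0 (agg_le u)).
have := le_trans du (ler_wpM2l C3_0 (dev_le u i)).
set x := u _ a 0; set y := mean_field u a 0 => h1 h2.
apply: (@le_trans _ _ (2 * ((x - y) ^+ 2 + y ^+ 2))).
  rewrite -subr_ge0.
  by rewrite (_ : _ - _ = (x - 2 * y) ^+ 2) ?sqr_ge0 //; ring.
rewrite -mulrA ler_pM2l // (mulrDl _ _ (mfquad _ _ _)) -mulrA.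
exact: lerD.
Qed.

Section AggregateWeights.
Variables (R : realType) (dx du : nat) (m : lf_model R dx du) (t : nat).

Lemma Qbar_sym : (lQ m t)^T = lQ m t -> (fQ m t)^T = fQ m t ->
  (fP m t)^T = fP m t -> (Qbar m t)^T = Qbar m t.
Proof.
by move=> s1 s2 s3; rewrite /Qbar tr_block_mx !linearD !linearN /= s1 s2 s3.
Qed.

Lemma Rbar_sym : (lR m t)^T = lR m t -> (fR m t)^T = fR m t ->
  (Rbar m t)^T = Rbar m t.
Proof. by move=> s1 s2; rewrite /Rbar tr_block_mx !trmx0 s1 s2. Qed.

Lemma Rbar_pd : pdmx (lR m t) -> pdmx (fR m t) -> pdmx (Rbar m t).
Proof.
move=> p1 p2 v; rewrite -[v]vsubmxK; set a := usubmx v; set b := dsubmx v.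
move=> v0; rewrite quadE /Rbar bil_block.
rewrite !bil_mx0 addr0 add0r; have [a0|a0] := eqVneq a 0; last first.
  by apply: ltr_pwDl; [exact: p1|exact: (pdmx_psd p2)].
have b0 : b != 0 by apply: contra_neq v0 => ->; rewrite a0 col_mx0.
by rewrite a0 bil0l add0r; exact: p2.
Qed.

End AggregateWeights.

Lemma measurable_col (R : realType) p q (k : 'I_q) :
  measurable_fun setT (col k : 'M[R]_(p, q) -> 'cV[R]_p).
Proof.
apply/measurable_mxP => a b; under eq_fun do rewrite mxE.
by have /measurable_mxP := @measurable_id _ 'M[R]_(p, q) setT; apply.
Qed.

(** Preimages under [f] lie in the sigma-algebra of the family indexed by [J], so [independent_past]
    makes [f] independent of [phi \o X i], and [expectation_mul_indep0] concludes. *)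
Lemma centered_mul_past (d d' : measure_display) (Om : measurableType d)
    (R : realType) (Pr : probability Om R) (I : finType) (V : measurableType d')
    (X : I -> Om -> V) (J : {set I}) (i : I) (f : Om -> R) (phi : V -> R) :
  (forall k, measurable_fun setT (X k)) -> mutually_independent Pr X ->
  i \notin J ->
  measurable_fun (setT : set (g_sigma_algebraType (cylinders X J))) f ->
  measurable_fun setT phi ->
  f \in Lfun Pr 2%:E -> phi \o X i \in Lfun Pr 2%:E ->
  centered Pr (phi \o X i) ->
  centered Pr (fun om => f om * phi (X i om)).
Proof.
move=> mX indX iJ mf mphi f2 phi2 [_ phi0]; split; first exact: Lfun2_mul_Lfun1.
pose f' : {mfun Om >-> R} := mfun_Sub (sub_Lfun_mfun f2).
pose g' : {mfun Om >-> R} := mfun_Sub (sub_Lfun_mfun phi2).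
apply: (@expectation_mul_indep0 _ _ _ Pr f' g') => // A B mA mB.
apply: (@independent_past _ _ _ _ _ _ _ _ mX indX _ _ iJ
  (f @^-1` A) (phi @^-1` B)).
  by have := mf measurableT A mA; rewrite setTI.
by rewrite -[_ @^-1` _]setTI; exact: mphi.
Qed.

(** * The cost as a function of the strategy *)

Lemma col_joint (R : realType) n dx (Om : Type)
    (X : 'I_n.+1 -> Om -> 'cV[R]_dx) k om : col k (joint X om) = X k om.
Proof. by apply/colP => a; rewrite !mxE. Qed.

Lemma measurable_joint (d : measure_display) (Om : measurableType d)
    (R : realType) n dx (X : 'I_n.+1 -> Om -> 'cV[R]_dx) :
  (forall k, measurable_fun setT (X k)) -> measurable_fun setT (joint X).
Proof.
move=> mX; apply/measurable_mxP => a k; under eq_fun do rewrite mxE.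
by have /measurable_mxP := mX k; apply.
Qed.

Section LeaderFollower.
Context (R : realType) (n T dx du : nat) (m : lf_model R dx du).
Context (d : measure_display) (Om : measurableType d) (Pr : probability Om R).
Variables (x1 : 'I_n.+1 -> Om -> 'cV[R]_dx).
Variables (w : nat -> 'I_n.+1 -> Om -> 'cV[R]_dx).
Variables (Mbreve : nat -> 'M[R]_dx) (Mbar : nat -> 'M[R]_(dx + dx)).
Hypothesis n_gt0 : (0 < n)%N.
Hypothesis sym : forall t, (1 <= t <= T)%N ->
  [/\ (lQ m t)^T = lQ m t, (lR m t)^T = lR m t & (fQ m t)^T = fQ m t] /\
  [/\ (fP m t)^T = fP m t, (fR m t)^T = fR m t & (fH m t)^T = fH m t].
Hypothesis mx1 : forall k, measurable_fun setT (x1 k).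
Hypothesis mw : forall t k, measurable_fun setT (w t k).
Hypothesis x1_L2 : forall k, square_integrable_vec Pr (x1 k).
Hypothesis w_L2 : forall t, (1 <= t <= T)%N ->
  forall k, square_integrable_vec Pr (w t k).
Hypothesis w_mean0 : forall t, (1 <= t <= T)%N ->
  forall k, zero_mean_vec Pr (w t k).
Hypothesis indep : mutually_independent Pr (@primitives R n T dx Om x1 w).
Hypothesis QPH_psd : forall t, (1 <= t <= T)%N ->
  psdmx (fQ m t + fP m t + fH m t).
Hypothesis Qbar_psd : forall t, (1 <= t <= T)%N -> psdmx (Qbar m t).
Hypothesis lR_pd : forall t, (1 <= t <= T)%N -> pdmx (lR m t).
Hypothesis fR_pd : forall t, (1 <= t <= T)%N -> pdmx (fR m t).
Hypothesis Mbreve_end : Mbreve T.+1 = 0.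
Hypothesis Mbreve_rec : forall t, (1 <= t <= T)%N ->
  Mbreve t = riccati (fA m t) (fB m t) (fQ m t + fP m t + fH m t)
               (fR m t) (Mbreve t.+1).
Hypothesis Mbar_end : Mbar T.+1 = 0.
Hypothesis Mbar_rec : forall t, (1 <= t <= T)%N ->
  Mbar t = riccati (Abar m t) (Bbar m t) (Qbar m t) (Rbar m t) (Mbar t.+1).

Let fR_sym t : (1 <= t <= T)%N -> (fR m t)^T = fR m t.
Proof. by move=> /sym[_ []]. Qed.

Let Ra_sym t : (1 <= t <= T)%N -> (Rbar m t)^T = Rbar m t.
Proof. by move=> /sym[[_ ? _] [_ ? _]]; exact: Rbar_sym. Qed.

Let Ra_pd t : (1 <= t <= T)%N -> pdmx (Rbar m t).
Proof. by move=> tT; apply: Rbar_pd; [exact: lR_pd|exact: fR_pd]. Qed.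

Lemma riccati_sequences t : (1 <= t <= T.+1)%N ->
  [/\ (Mbreve t)^T = Mbreve t, psdmx (Mbreve t),
      (Mbar t)^T = Mbar t & psdmx (Mbar t)].
Proof.
(* The recursion runs backwards, so the induction is on the distance from [t] to the terminal time
   [T.+1]. *)
move=> /andP[t1 tT]; rewrite -(subKn tT).
have : (T.+1 - t <= T)%N by rewrite leq_subLR -add1n leq_add2r.
elim: (T.+1 - t)%N => [_|s IH sT].
  by rewrite subn0 Mbreve_end Mbar_end !trmx0; split=> //; exact: psdmx0.
have {}IH := IH (ltnW sT).
have rT : (1 <= T.+1 - s.+1 <= T)%N by rewrite subSS subn_gt0 sT leq_subr.
have rS : (T.+1 - s.+1).+1 = (T.+1 - s)%N by rewrite subSS subSn // ltnW.
have [[s1 s2 s3] [s4 s5 s6]] := sym rT.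
rewrite Mbreve_rec // Mbar_rec // rS; case: IH => sd pd sa pa; split.
- by apply: riccati_sym => //; rewrite ?linearD /= ?s3 ?s4 ?s6.
- by apply: riccati_psd => //; [exact: fR_pd|exact: QPH_psd].
- by apply: riccati_sym => //; [exact: Ra_sym|exact: Qbar_sym].
- by apply: riccati_psd => //; [exact: Ra_sym|exact: Ra_pd|exact: Qbar_psd].
Qed.

Let next t : (1 <= t <= T)%N -> (1 <= t.+1 <= T.+1)%N.
Proof. by move=> /andP[]. Qed.

Notation Ga t := (gram (Bbar m t) (Rbar m t) (Mbar t.+1)).
Notation Gd t := (gram (fB m t) (fR m t) (Mbreve t.+1)).

Lemma grams_pd t : (1 <= t <= T)%N -> pdmx (Ga t) /\ pdmx (Gd t).
Proof.
move=> tT; have [_ pd _ pa] := riccati_sequences (next tT).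
by split; apply: gram_pd => //; [exact: Ra_pd|exact: fR_pd].
Qed.

Let gstar := feedback n
  (fun t => gain (Abar m t) (Bbar m t) (Rbar m t) (Mbar t.+1))
  (fun t => gain (fA m t) (fB m t) (fR m t) (Mbreve t.+1)).

Notation st g t om := (state m g (x1 ^~ om) (fun s => w s ^~ om) t).
Notation ac g t om := (action m g (x1 ^~ om) (fun s => w s ^~ om) t).
Notation V t := (mfquad (Mbar t) (Mbreve t)).

(** [gstar] is evaluated at the state reached under [g], not along its own trajectory. *)
Let gap g t om :=
  mfquad (Ga t) (Gd t) (fun k => ac g t om k - control gstar t (st g t om) k).

(** The first argument is the noise-free successor, which depends only on the primitive variables
    preceding the noise at time [t]. *)
Let cross g t om := mfbil (Mbar t.+1) (Mbreve t.+1)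
  (dynamics m t (st g t om) (ac g t om) (fun=> 0)) (w t ^~ om).

Let base om :=
  V 1%N (x1 ^~ om) + \sum_(1 <= t < T.+1) V t.+1 (w t ^~ om).

(** Summing [bellman_step] over time, the values [V t] along the trajectory telescope: the initial
    one enters [base], the terminal one is zero. *)
Lemma path_costE g om :
  path_cost T m g (x1 ^~ om) (fun s => w s ^~ om) =
  base om + \sum_(1 <= t < T.+1) gap g t om
  + \sum_(1 <= t < T.+1) 2 * cross g t om.
Proof.
have step t : (1 <= t < T.+1)%N -> stage_cost m t (st g t om) (ac g t om) =
    gap g t om + 2 * cross g t om + V t.+1 (w t ^~ om)
    - (V t.+1 (st g t.+1 om) - V t (st g t om)).
  rewrite ltnS => tT; have [sd pd sa pa] := riccati_sequences (next tT).
  have := bellman_step (st g t om) (ac g t om) (w t ^~ om) n_gt0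
    (Ra_sym tT) (Ra_pd tT) (fR_sym tT) (fR_pd tT) sa pa sd pd
    (La := fun t => gain (Abar m t) (Bbar m t) (Rbar m t) (Mbar t.+1))
    (Ld := fun t => gain (fA m t) (fB m t) (fR m t) (Mbreve t.+1))
    erefl erefl.
  rewrite -Mbar_rec // -Mbreve_rec // -/gstar -/(gap g t om) -/(cross g t om).
  have -> : dynamics m t (st g t om) (ac g t om) (w t ^~ om) = st g t.+1 om.
    (* [state] unfolds to [dynamics] only for [t] at least 1; the successor of the dummy time 0 is
       the initial state. *)
    by case: (t) tT.
  by move=> h; rewrite -[LHS](addrK (V t.+1 (st g t.+1 om))) h; ring.
have V_end x : V T.+1 x = 0.
  rewrite Mbar_end Mbreve_end /mfquad /mfbil bil_mx0 big1 ?mulr0 ?addr0 //.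
  by move=> i _; exact: bil_mx0.
rewrite /path_cost (eq_big_nat _ _ step) sumrB telescope_sumr // 2!big_split /=.
by rewrite V_end /base; ring.
Qed.

Lemma L2_dynamics t (x : 'I_n.+1 -> Om -> 'cV[R]_dx)
    (u : 'I_n.+1 -> Om -> 'cV[R]_du) (v : 'I_n.+1 -> Om -> 'cV[R]_dx) :
  (forall k, square_integrable_vec Pr (x k)) ->
  (forall k, square_integrable_vec Pr (u k)) ->
  (forall k, square_integrable_vec Pr (v k)) ->
  forall k, square_integrable_vec Pr
    (fun om => dynamics m t (x ^~ om) (u ^~ om) (v ^~ om) k).
Proof.
move=> x2 u2 v2 k; have mm2 := L2_mean_field x2.
rewrite /dynamics; case: unliftP => [i _|_];
  by repeat apply: L2D => //; exact: L2_mulmx.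
Qed.

(** The induction common to two cases: under [gstar] the actions inherit square integrability from
    the states, while under a strategy of finite cost they get it from the cost. *)
Lemma L2_closed_loop g :
  (forall t, (1 <= t <= T)%N ->
     (forall k, square_integrable_vec Pr (fun om => st g t om k)) ->
     forall k, square_integrable_vec Pr (fun om => ac g t om k)) ->
  forall t, (1 <= t <= T)%N ->
    (forall k, square_integrable_vec Pr (fun om => st g t om k)) /\
    (forall k, square_integrable_vec Pr (fun om => ac g t om k)).
Proof.
move=> acL t tT.
suff stL : forall k, square_integrable_vec Pr (fun om => st g t om k).
  by split=> //; exact: acL.
elim: t tT => [//|[|t] IH] tT; first exact: x1_L2.
have tT' : (1 <= t.+1 <= T)%N by case/andP: tT => _ /ltnW.
apply: (@L2_dynamics t.+1 (fun k om => st g t.+1 om k)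
  (fun k om => ac g t.+1 om k) (w t.+1)); [exact: IH| |exact: w_L2].
by apply: acL => //; exact: IH.
Qed.

Lemma L2_control_gstar t (x : 'I_n.+1 -> Om -> 'cV[R]_dx) :
  (forall k, square_integrable_vec Pr (x k)) ->
  forall k, square_integrable_vec Pr (fun om => control gstar t (x ^~ om) k).
Proof.
move=> x2 k; have mm2 := L2_mean_field x2.
rewrite /control; case: unliftP => [i _|_];
  by repeat apply: L2D => //; exact: L2_mulmx.
Qed.

Lemma L2_gstar t : (1 <= t <= T)%N ->
    (forall k, square_integrable_vec Pr (fun om => st gstar t om k)) /\
    (forall k, square_integrable_vec Pr (fun om => ac gstar t om k)).
Proof.
move: t; apply: L2_closed_loop => t tT x2.
exact: (@L2_control_gstar t (fun k om => st gstar t om k)).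
Qed.

Lemma base_L1 : base \in Lfun Pr 1.
Proof.
apply: LfunD => //; first exact: Lfun1_mfbil.
(* [big_seq] retains membership of [t] in the index range, which the hypotheses at time [t]
   require. *)
under eq_fun do rewrite big_seq.
apply: Lfun_sum => // t; rewrite mem_index_iota ltnS => tT.
by apply: Lfun1_mfbil; exact: w_L2.
Qed.

(** * Expected cost of one admissible strategy *)

Section Strategy.
Variable g : strategy R n dx du.
Hypothesis ag : admissible T g.

Let mst t : (1 <= t <= T)%N ->
  forall k, measurable_fun setT (fun om => st g t om k).
Proof. by move=> tT; apply: (measurable_state m ag tT). Qed.

Let mac t : (1 <= t <= T)%N ->
  forall k, measurable_fun setT (fun om => ac g t om k).
Proof.
by move=> tT; apply: (measurable_control (x := fun k om => st g t om k) ag tT);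
  exact: mst.
Qed.

Let stage_ge t om : (1 <= t <= T)%N ->
  mfquad (Rbar m t) (fR m t) (ac g t om) <=
  stage_cost m t (st g t om) (ac g t om).
Proof.
move=> tT; rewrite stage_costE // lerDr mfquad_ge0 //; first exact: Qbar_psd.
exact: QPH_psd.
Qed.

Let stage_ge0 t om : (1 <= t <= T)%N ->
  0 <= stage_cost m t (st g t om) (ac g t om).
Proof.
move=> tT; apply: le_trans (stage_ge om tT); apply: mfquad_ge0.
  exact/pdmx_psd/Ra_pd.
exact/pdmx_psd/fR_pd.
Qed.

Let path_ge0 om : 0 <= path_cost T m g (x1 ^~ om) (fun s => w s ^~ om).
Proof.
rewrite /path_cost big_seq sumr_ge0 // => t.
by rewrite mem_index_iota ltnS => /stage_ge0.
Qed.

Let path_ge t om : (1 <= t <= T)%N ->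
  mfquad (Rbar m t) (fR m t) (ac g t om) <=
  path_cost T m g (x1 ^~ om) (fun s => w s ^~ om).
Proof.
move=> tT; apply: le_trans (stage_ge om tT) _.
rewrite /path_cost (bigD1_seq t) ?iota_uniq ?mem_index_iota ?ltnS //=.
rewrite lerDl big_seq_cond sumr_ge0 // => s.
by rewrite mem_index_iota ltnS => /andP[/stage_ge0].
Qed.

Let mpath : measurable_fun setT
  (fun om => path_cost T m g (x1 ^~ om) (fun s => w s ^~ om)).
Proof.
rewrite /path_cost; under eq_fun do rewrite big_seq big_mkcond.
apply: measurable_sum => t; rewrite mem_index_iota ltnS.
have [tT|_] := boolP (1 <= t <= T)%N; last exact: measurable_cst.
under eq_fun do rewrite stage_costE //.
apply: measurable_funD.
  by apply: (measurable_mfbil _ _ (x := fun k om => st g t om k)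
    (y := fun k om => st g t om k)); exact: mst.
by apply: (measurable_mfbil _ _ (x := fun k om => ac g t om k)
  (y := fun k om => ac g t om k)); exact: mac.
Qed.

(** The path cost is nonnegative and dominates the [Rbar] form of each action, which by
    [mfquad_coord_bound] dominates the square of each coordinate up to a constant. The states follow
    through the dynamics. *)
Lemma finite_cost_L2 : (total_cost T m Pr x1 w g < +oo)%E ->
  forall t, (1 <= t <= T)%N ->
    (forall k, square_integrable_vec Pr (fun om => st g t om k)) /\
    (forall k, square_integrable_vec Pr (fun om => ac g t om k)).
Proof.
move=> Jfin; apply: L2_closed_loop => t tT _ k a.
have path1 := Lfun1_ge0_lty mpath path_ge0 Jfin.
have [C C0 CR] := mfquad_coord_bound k a n_gt0
  (Ra_sym tT) (Ra_pd tT) (fR_sym tT) (fR_pd tT).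
apply: (Lfun2_sqr_le
  (h := fun om => C * path_cost T m g (x1 ^~ om) (fun s => w s ^~ om))).
- by have /measurable_mxP := mac tT k; apply.
- exact: LfunMl.
- move=> om; apply: le_trans (CR (ac g t om)) _.
  exact/ler_wpM2l/path_ge.
Qed.

Hypothesis gL2 : forall t, (1 <= t <= T)%N ->
    (forall k, square_integrable_vec Pr (fun om => st g t om k)) /\
    (forall k, square_integrable_vec Pr (fun om => ac g t om k)).

Lemma sum_gap_L1 : (fun om => \sum_(1 <= t < T.+1) gap g t om) \in Lfun Pr 1.
Proof.
under eq_fun do rewrite big_seq.
apply: Lfun_sum => // t; rewrite mem_index_iota ltnS => tT.
have [st2 ac2] := gL2 tT.
have diff2 k : square_integrable_vec Pr
    (fun om => ac g t om k - control gstar t (st g t om) k).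
  rewrite (_ : (fun om => _) = fun om => ac g t om k
    + (- 1)%:M *m control gstar t (st g t om) k).
    apply: L2D => //; apply: L2_mulmx.
    exact: (@L2_control_gstar t (fun k om => st g t om k)).
  by apply/funext => om; rewrite mul_scalar_mx scaleN1r.
by apply: (Lfun1_mfbil _ _
  (x := fun k om => ac g t om k - control gstar t (st g t om) k)
  (y := fun k om => ac g t om k - control gstar t (st g t om) k)).
Qed.

(** [Om] with the information available before the noise at time [t] is drawn: index 0 contributes
    the initial states, indices 1 to t - 1 the earlier noises. *)
Let past t : measurableType _ :=
  g_sigma_algebraType (cylinders (@primitives R n T dx Om x1 w)
    [set s : 'I_T.+1 | (s < t)%N]).

Let past_primitive t (s : 'I_T.+1) : (s < t)%N ->
  measurable_fun (setT : set (past t)) (primitives x1 w s).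
Proof.
move=> lt_st _ B mB; rewrite setTI; apply: sub_sigma_algebra.
by apply: cylinder_preimage => //; rewrite inE.
Qed.

Let past_x1 t k : (1 <= t)%N -> measurable_fun (setT : set (past t)) (x1 k).
Proof.
move=> t1; rewrite (_ : x1 k = col k \o primitives x1 w (ord0 : 'I_T.+1)).
  by apply: (measurableT_comp (@measurable_col _ _ _ k)); exact: past_primitive.
by apply/funext => om; rewrite /primitives /= col_joint.
Qed.

Let past_w t s k : (1 <= s < t)%N -> (t <= T)%N ->
  measurable_fun (setT : set (past t)) (w s k).
Proof.
move=> /andP[s1 lt_st] tT.
have sT : (s < T.+1)%N by rewrite ltnS (leq_trans (ltnW lt_st)).
rewrite (_ : w s k = col k \o primitives x1 w (Ordinal sT)).
  by apply: (measurableT_comp (@measurable_col _ _ _ k)); exact: past_primitive.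
by apply/funext => om; rewrite /primitives /= gtn_eqF // col_joint.
Qed.

Let past_next t k : (1 <= t <= T)%N -> measurable_fun (setT : set (past t))
  (fun om => dynamics m t (st g t om) (ac g t om) (fun=> 0) k).
Proof.
move=> tT; have /andP[t1 tT'] := tT.
have mst' : forall l,
    measurable_fun (setT : set (past t)) (fun om => st g t om l).
  apply: (@measurable_state _ (past t) _ _ _ _ T m g t x1 w ag tT).
    by move=> l; exact: past_x1.
  by move=> s l lt_st; exact: past_w.
apply: (@measurable_dynamics _ (past t) _ _ _ _ m t (fun k om => st g t om k)
  (fun k om => ac g t om k) (fun _ _ => 0)) => // l.
exact: (@measurable_control _ (past t) _ _ _ _ T g t (fun k om => st g t om k)).
Qed.

(** Independence concerns the joint matrix of all agents' noises; [psi] is transported to that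
    matrix by reading its columns. *)
Let centered_past t (f : Om -> R) (psi : ('I_n.+1 -> 'cV[R]_dx) -> R) :
  (1 <= t <= T)%N -> measurable_fun (setT : set (past t)) f ->
  measurable_fun setT (fun M : 'M[R]_(dx, n.+1) => psi (fun k => col k M)) ->
  f \in Lfun Pr 2%:E -> (fun om => psi (w t ^~ om)) \in Lfun Pr 2%:E ->
  centered Pr (fun om => psi (w t ^~ om)) ->
  centered Pr (fun om => f om * psi (w t ^~ om)).
Proof.
move=> /andP[t1 tT] mf mpsi f2 psi2 psi0.
have tT' : (t < T.+1)%N by rewrite ltnS.
pose phi := fun M : 'M[R]_(dx, n.+1) => psi (fun k => col k M).
have phiE om : phi (primitives x1 w (Ordinal tT') om) = psi (w t ^~ om).
  rewrite /phi /primitives /= gtn_eqF //; congr psi.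
  by apply/funext => k; rewrite col_joint.
have phiE' : phi \o primitives x1 w (Ordinal tT') = fun om => psi (w t ^~ om).
  exact/funext.
under eq_fun do rewrite -phiE.
apply: (centered_mul_past (J := [set s : 'I_T.+1 | (s < t)%N])) => //.
- move=> s; rewrite /primitives; case: ifP => _; exact: measurable_joint.
- by rewrite inE /= ltnn.
- by rewrite phiE'.
- by rewrite phiE'.
Qed.

(** The noise-free successor is measurable for [past t] and square-integrable, so each of its
    entries is multiplied by a centered quantity independent of it. *)
Let cross_centered t : (1 <= t <= T)%N -> centered Pr (cross g t).
Proof.
move=> tT; have [st2 ac2] := gL2 tT.
pose y k om := dynamics m t (st g t om) (ac g t om) (fun=> 0) k.
have my k : measurable_fun (setT : set (past t)) (y k) by exact: past_next.
have y2 : forall k, square_integrable_vec Pr (y k).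
  apply: (@L2_dynamics t (fun k om => st g t om k) (fun k om => ac g t om k)
    (fun _ _ => 0)) => // k a.
  by under eq_fun do rewrite mxE; exact: Lfun_cst.
have w2 := w_L2 tT.
have w0 k a : centered Pr (fun om => w t k om a 0).
  by apply: zero_mean_centered => //; exact: w_mean0.
have mcol k : measurable_fun setT (fun M : 'M[R]_(dx, n.+1) => col k M).
  exact: measurable_col.
apply: centeredD; last apply: centeredMl; last apply: centered_sum => i _;
  apply: centered_bil => a b.
- apply: (centered_past (psi := fun v => agg v b 0)) => //.
  + by have /measurable_mxP := measurable_agg my; apply.
  + by have /measurable_mxP := measurable_agg mcol; apply.
  + exact: (L2_agg y2).
  + exact: (L2_agg w2).
  + exact: (centered_agg w0).
- apply: (centered_past (psi := fun v => dev v i b 0)) => //.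
  + by have /measurable_mxP := measurable_dev i my; apply.
  + by have /measurable_mxP := measurable_dev i mcol; apply.
  + exact: (L2_dev i y2).
  + exact: (L2_dev i w2).
  + exact: (centered_dev i w0).
Qed.

Lemma total_costE : total_cost T m Pr x1 w g =
  ('E_Pr[base] + 'E_Pr[fun om => (\sum_(1 <= t < T.+1) gap g t om)%R])%E.
Proof.
have [cr1 cr0] : centered Pr (fun om => \sum_(1 <= t < T.+1) 2 * cross g t om).
  under eq_fun do rewrite big_seq.
  apply: centered_sum => t; rewrite mem_index_iota ltnS => tT.
  exact/centeredMl/cross_centered.
rewrite /total_cost; under eq_fun do rewrite path_costE.
have L1 := LfunD (lexx _) base_L1 sum_gap_L1.
rewrite expectationD // expectationD ?cr0 ?adde0 //; first exact: base_L1.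
exact: sum_gap_L1.
Qed.

End Strategy.

(** * Optimality of [gstar] and almost sure uniqueness *)

Lemma gap_ge0 g t om : (1 <= t <= T)%N -> 0 <= gap g t om.
Proof.
by move=> tT; have [pa pd] := grams_pd tT; apply: mfquad_ge0; exact: pdmx_psd.
Qed.

Lemma sum_gap_ge0 g om : 0 <= \sum_(1 <= t < T.+1) gap g t om.
Proof.
rewrite big_seq sumr_ge0 // => t; rewrite mem_index_iota ltnS.
exact: gap_ge0.
Qed.

Lemma sum_gap_gstar om : \sum_(1 <= t < T.+1) gap gstar t om = 0.
Proof.
have subuu (u : 'I_n.+1 -> 'cV[R]_du) : (fun k => u k - u k) = fun=> 0.
  by apply/funext => k; exact: subrr.
apply: big1 => t _; rewrite /gap /action subuu.
rewrite /mfquad /mfbil agg0 // bil0r big1 ?mulr0 ?addr0 // => i _.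
by rewrite dev0 // bil0r.
Qed.

Lemma admissible_gstar : admissible T gstar.
Proof.
by move=> t tT; split=> [|i]; do ?apply: measurable_addmx;
  apply: measurable_mulmx => //; exact: measurableT_comp.
Qed.

Lemma total_cost_gstar : total_cost T m Pr x1 w gstar = ('E_Pr[base])%E.
Proof.
rewrite (total_costE admissible_gstar L2_gstar).
under [X in (_ + 'E_Pr[X])%E]eq_fun do rewrite sum_gap_gstar.
by rewrite expectation_cst adde0.
Qed.

Lemma optimal_gstar : optimal T m Pr x1 w gstar.
Proof.
split=> [|g ag]; first exact: admissible_gstar.
(* A strategy of infinite cost loses trivially; finite cost gives the integrability that
   [total_costE] asks for. *)
have [Jfin|] := ltP (total_cost T m Pr x1 w g) +oo%E; last first.
  exact: le_trans (leey _).
rewrite (total_costE ag (finite_cost_L2 ag Jfin)) total_cost_gstar leeDl //.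
by apply: expectation_ge0 => om; exact: sum_gap_ge0.
Qed.

(** Comparison with [gstar] bounds the cost by the finite expectation of [base]; cancelling it
    leaves a nonnegative sum with expectation at most zero. *)
Lemma optimal_sum_gap0 g : optimal T m Pr x1 w g ->
  {ae Pr, forall om, \sum_(1 <= t < T.+1) gap g t om = 0}.
Proof.
move=> [ag /(_ _ admissible_gstar)]; rewrite total_cost_gstar => le_base.
have base_fin : ('E_Pr[base])%E \is a fin_num.
  exact/expectation_fin_num/base_L1.
have Jfin : (total_cost T m Pr x1 w g < +oo)%E.
  by apply: le_lt_trans le_base _; rewrite ltey_eq base_fin.
have gL2 := finite_cost_L2 ag Jfin.
have gaps1 := sum_gap_L1 gL2.
move: le_base; rewrite (total_costE ag gL2) -[X in (_ <= X)%E]adde0.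
rewrite leeD2lE // => le0.
have mgaps : measurable_fun setT
    (EFin \o fun om => \sum_(1 <= t < T.+1) gap g t om).
  by apply/measurable_EFinP; exact: Lfun_measurable gaps1.
have [+ _] := ae_eq_integral_abs Pr measurableT mgaps.
have -> : (\int[Pr]_om
    `|(EFin \o (fun om => (\sum_(1 <= t < T.+1) gap g t om)%R)) om| = 0)%E.
  apply/eqP; rewrite eq_le integral_ge0 // andbT.
  move: le0; rewrite unlock; congr (_ <= _)%E; apply: eq_integral => om _.
  by rewrite gee0_abs // lee_fin sum_gap_ge0.
by move=> /(_ erefl); apply: filterS => om /(_ I) [].
Qed.

(** Pathwise: positive definite gaps that vanish force the action of [gstar] at every state reached
    by [g]. From equal initial states and noises the two trajectories then coincide by induction. *)
Lemma sum_gap0_trajectory g om : \sum_(1 <= t < T.+1) gap g t om = 0 ->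
  forall t, (1 <= t <= T)%N ->
    st g t om = st gstar t om /\ ac g t om = ac gstar t om.
Proof.
move=> /eqP; rewrite big_seq psumr_eq0 => [/allP gap0|t]; last first.
  by rewrite mem_index_iota ltnS; exact: gap_ge0.
have acE t : (1 <= t <= T)%N -> ac g t om = control gstar t (st g t om).
  move=> tT; have [pa pd] := grams_pd tT; apply/funext => k.
  have tI : t \in index_iota 1 T.+1 by rewrite mem_index_iota ltnS.
  have := gap0 t tI; rewrite tI /=.
  move=> /eqP /(mfquad_eq0 n_gt0 pa pd) /(_ k) /eqP.
  by rewrite subr_eq0 => /eqP.
move=> t tT; suff stE : st g t om = st gstar t om.
  by split=> //; rewrite acE // stE.
elim: t tT => [//|[//|t] IH] tT.
have tT' : (1 <= t.+1 <= T)%N by case/andP: tT => _ /ltnW.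
rewrite -[LHS]/(dynamics m t.+1 (st g t.+1 om) (ac g t.+1 om) (w t.+1 ^~ om)).
by rewrite acE // IH.
Qed.

Lemma optimal_trajectory g : optimal T m Pr x1 w g ->
  {ae Pr, forall om, forall t, (1 <= t <= T)%N ->
    st g t om = st gstar t om /\ ac g t om = ac gstar t om}.
Proof.
by move=> /optimal_sum_gap0; apply: filterS => om; exact: sum_gap0_trajectory.
Qed.

End LeaderFollower.

(** Invertibility of the two [gram] matrices makes [invmx] a genuine inverse in the gains and
    recursions. Uniqueness concerns realized states and actions almost surely, since values of a
    strategy at points that are almost never reached leave the cost unchanged. *)
Theorem theorem1 (R : realType) (n T dx du : nat) (m : lf_model R dx du)
    (d : measure_display) (Om : measurableType d) (Pr : probability Om R)
    (x1 : 'I_n.+1 -> {RV Pr >-> 'cV[R]_dx})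
    (w : nat -> 'I_n.+1 -> {RV Pr >-> 'cV[R]_dx})
    (Mbreve : nat -> 'M[R]_dx) (Mbar : nat -> 'M[R]_(dx + dx))
    (n_gt0 : (0 < n)%N)
    (sym : forall t, (1 <= t <= T)%N ->
       [/\ (lQ m t)^T = lQ m t, (lR m t)^T = lR m t & (fQ m t)^T = fQ m t] /\
       [/\ (fP m t)^T = fP m t, (fR m t)^T = fR m t & (fH m t)^T = fH m t])
    (x1_L2 : forall k, square_integrable_vec Pr (x1 k))
    (w_L2 : forall t, (1 <= t <= T)%N ->
       forall k, square_integrable_vec Pr (w t k))
    (w_mean0 : forall t, (1 <= t <= T)%N ->
       forall k, zero_mean_vec Pr (w t k))
    (indep : mutually_independent Pr
       (@primitives R n T dx Om (fun k => x1 k) (fun t k => w t k)))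
    (QPH_psd : forall t, (1 <= t <= T)%N -> psdmx (fQ m t + fP m t + fH m t))
    (Qbar_psd : forall t, (1 <= t <= T)%N -> psdmx (Qbar m t))
    (lR_pd : forall t, (1 <= t <= T)%N -> pdmx (lR m t))
    (fR_pd : forall t, (1 <= t <= T)%N -> pdmx (fR m t))
    (Mbreve_end : Mbreve T.+1 = 0)
    (Mbreve_rec : forall t, (1 <= t <= T)%N ->
       Mbreve t = riccati (fA m t) (fB m t) (fQ m t + fP m t + fH m t)
                    (fR m t) (Mbreve t.+1))
    (Mbar_end : Mbar T.+1 = 0)
    (Mbar_rec : forall t, (1 <= t <= T)%N ->
       Mbar t = riccati (Abar m t) (Bbar m t) (Qbar m t)
                  (Rbar m t) (Mbar t.+1)) :
  let Lbreve := fun t => gain (fA m t) (fB m t) (fR m t) (Mbreve t.+1) in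
  let Lbar := fun t => gain (Abar m t) (Bbar m t) (Rbar m t) (Mbar t.+1) in
  let gstar := Strategy
    (fun t (x0 xbar : 'cV[R]_dx) =>
       ulsubmx (Lbar t) *m x0 + ursubmx (Lbar t) *m xbar)
    (fun t (i : 'I_n) (xi xbar x0 : 'cV[R]_dx) =>
       Lbreve t *m xi + dlsubmx (Lbar t) *m x0
       + (drsubmx (Lbar t) - Lbreve t) *m xbar) in
  [/\ forall t, (1 <= t <= T)%N ->
        gram (fB m t) (fR m t) (Mbreve t.+1) \in unitmx /\
        gram (Bbar m t) (Rbar m t) (Mbar t.+1) \in unitmx,
      optimal T m Pr (fun k => x1 k) (fun t k => w t k) gstar
    & forall g, optimal T m Pr (fun k => x1 k) (fun t k => w t k) g ->
        {ae Pr, forall om, forall t, (1 <= t <= T)%N -> forall k : 'I_n.+1,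
           let x1om := fun k => x1 k om in
           let wom := fun t k => w t k om in
           state m g x1om wom t k = state m gstar x1om wom t k /\
           action m g x1om wom t k = action m gstar x1om wom t k}].

Proof.
move=> Lbreve Lbar gstar.
have mx1 k : measurable_fun setT (x1 k) by exact: measurable_funP.
have mw t k : measurable_fun setT (w t k) by exact: measurable_funP.
split.
- move=> t tT.
  have [pa pd] := grams_pd sym QPH_psd Qbar_psd lR_pd fR_pd Mbreve_end
    Mbreve_rec Mbar_end Mbar_rec tT.
  by split; exact: pdmx_unit.
- exact: (optimal_gstar n_gt0 sym mx1 mw x1_L2 w_L2 w_mean0 indep QPH_psd
    Qbar_psd lR_pd fR_pd Mbreve_end Mbreve_rec Mbar_end Mbar_rec).
- move=> g gopt; apply: filterS (optimal_trajectory n_gt0 sym mx1 mw x1_L2 w_L2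
    w_mean0 indep QPH_psd Qbar_psd lR_pd fR_pd Mbreve_end Mbreve_rec Mbar_end
    Mbar_rec gopt) => om eq_traj t tT k.
  by have [stE acE] := eq_traj t tT; split; [rewrite stE|rewrite acE].
Qed.
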